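(* Let $m$ be a positive integer, let $K\in C^{[m]}(I^2)$ be independent of $\kappa$, let $f\in\tilde H^m_{\kappa,0}(I)$, assume $1$ is not an eigenvalue of $\mathcal{K}$ for any $\kappa>1$, and let $y$ be the solution of $y-\mathcal{K}y=f$. Suppose the equation is solved by the oscillation preserving Galerkin method based on the B-spline basis of order $m$ on a uniform partition with mesh size $h$, leading to the linear system $(\mathbf E_d-\mathbf K_d)\mathbf a=\mathbf f_d$. Then there exist constants $c$ and $h_0$ such that for every $0<h<h_0$ there exists a constant $\kappa_0$ such that $\mathrm{Cond}(\mathbf E_d-\mathbf K_d)\le c$ for all $\kappa\ge\kappa_0$.
   Context: $I=[-1,1]$; $\kappa\in(1,\infty)$; functions are complex-valued; $(u,v)=\int_Iu\bar v$; $(\mathcal{K}u)(s)=\int_IK(s,t)e^{i\kappa|s-t|}u(t)\,dt$. $C^{[m]}(I^2)$: functions on $I^2$ with continuous $\partial_s^\alpha\partial_t^\beta$ derivatives, $\alpha,\beta\le m$. $H^m(I)$ is the Sobolev space with $\|u\|_{H^m}=(\sum_{j=0}^m\|u^{(j)}\|_{L^2}^2)^{1/2}$; $H^m_{\kappa,0}(I)$: $\kappa$-parameterized $u\in H^m(I)$ with $\|u\|_{H^m}\le c$ for $\kappa\ge\kappa_0$; $\tilde H^m_{\kappa,0}(I)=\{u_0+u_1e^{i\kappa t}+u_2e^{-i\kappa t}:u_j\in H^m_{\kappa,0}(I)\}$. Uniform partition of $I$ with mesh $h$; $S_h^m$ the $C^{m-2}$ splines of order $m$ on it with B-spline basis $\{B_j:j=0,\dots,d-1\}$.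 The approximation space is $V^m_{\kappa,h}=\{w_1e^{i\kappa\cdot}+w_2e^{-i\kappa\cdot}+w_3:w_j\in S_h^m\}$ with basis $\{B_je^{i\kappa\cdot},B_je^{-i\kappa\cdot},B_j\}$; the method seeks $y_h\in V^m_{\kappa,h}$ with $(y_h,v)=(\mathcal{K}y_h,v)+(f,v)$ for all $v\in V^m_{\kappa,h}$. With $\epsilon_p=p-1$ for $p\in\{0,1,2\}$: $\mathbf E_{p,q}=[(B_le^{i\epsilon_p\kappa\cdot},B_je^{i\epsilon_q\kappa\cdot})]_{l,j}$, $\mathbf K_{p,q}=[(\mathcal{K}(B_le^{i\epsilon_p\kappa\cdot}),B_je^{i\epsilon_q\kappa\cdot})]_{l,j}$, $\mathbf E_d=[\mathbf E_{p,q}]_{p,q=0}^2$, $\mathbf K_d=[\mathbf K_{p,q}]_{p,q=0}^2$ (block matrices), $\mathbf f_d$ the vector of $(f,B_je^{i\epsilon_p\kappa\cdot})$. $\mathrm{Cond}$ denotes the matrix condition number. *)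

(* Defs.v *)
From mathcomp Require Import all_boot all_order all_algebra.
From mathcomp Require Import all_classical all_reals all_analysis.
From mathcomp Require Import complex.
Export complex.
Set Implicit Arguments.
Unset Strict Implicit.
Unset Printing Implicit Defensive.
Import Order.TTheory GRing.Theory Num.Theory.
Import numFieldNormedType.Exports.
Local Open Scope classical_set_scope.
Local Open Scope ring_scope.

Section Defs.
Variable R : realType.

Definition inI (x : R) : Prop := -1 <= x <= 1.

Definition has_deriv_on_I (g dg : R -> R) : Prop :=
  forall x, inI x ->
    (fun e : R => (g (x + e) - g x) / e)
      @ (within (fun e => inI (x + e)) 0^') --> dg x.

Definition cont_on_I2 (F : R -> R -> R) : Prop :=
  {within [set p : R * R | inI p.1 /\ inI p.2],
     continuous (fun p : R * R => F p.1 p.2)}.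

(* C^{[m]}(I^2) for real-valued functions: D a b stands for
   \partial_s^a \partial_t^b F, a, b <= m, all continuous on I^2 *)
Definition Cm_I2_real (m : nat) (F : R -> R -> R) : Prop :=
  exists D : nat -> nat -> R -> R -> R,
    [/\ (forall s t, inI s -> inI t -> D 0%N 0%N s t = F s t),
        (forall b s, (b < m)%N -> inI s ->
            has_deriv_on_I (D 0%N b s) (D 0%N b.+1 s)),
        (forall a b t, (a < m)%N -> (b <= m)%N -> inI t ->
            has_deriv_on_I (fun s => D a b s t) (fun s => D a.+1 b s t)) &
        (forall a b, (a <= m)%N -> (b <= m)%N -> cont_on_I2 (D a b))].

Definition Cm_I2 (m : nat) (K : R -> R -> R[i]) : Prop :=
  Cm_I2_real m (fun s t => complex.Re (K s t)) /\
  Cm_I2_real m (fun s t => complex.Im (K s t)).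

Definition cint (g : R -> R[i]) : R[i] :=
  ((\int[@lebesgue_measure R]_(x in `[-1, 1]) complex.Re (g x))
   +i* (\int[@lebesgue_measure R]_(x in `[-1, 1]) complex.Im (g x)))%C.

Definition ip (u v : R -> R[i]) : R[i] := cint (fun x => u x * (v x)^*%C).

Definition expi (x : R) : R[i] := (cos x +i* sin x)%C.

Definition Kop (K : R -> R -> R[i]) (kappa : R) (u : R -> R[i]) (s : R) :
  R[i] := cint (fun t => K s t * expi (kappa * `|s - t|) * u t).

Definition one_not_eigenvalue (K : R -> R -> R[i]) (kappa : R) : Prop :=
  forall u : R -> R[i],
    {within [set x | inI x], continuous (fun x => complex.Re (u x))} ->
    {within [set x | inI x], continuous (fun x => complex.Im (u x))} ->
    (forall s, inI s -> u s = Kop K kappa u s) ->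
    forall s, inI s -> u s = 0.

(* B-splines via the Cox--de Boor recursion; bspl t k i is the B-spline
   of order k+1 (degree k) with knots t i, ..., t (i+k+1).
   Division by 0 yields 0 (convention 0/0 = 0). *)
Fixpoint bspl (t : nat -> R) (k i : nat) (x : R) : R :=
  match k with
  | 0%N => if (t i <= x) && (x < t i.+1) then 1 else 0
  | k'.+1 => (x - t i) / (t (i + k'.+1)%N - t i) * bspl t k' i x
           + (t (i + k'.+2)%N - x) / (t (i + k'.+2)%N - t i.+1) * bspl t k' i.+1 x
  end.

(* uniform partition of I into N subintervals, mesh h = 2/N; clamped
   (open) knot sequence: -1 and 1 with multiplicity m *)
Definition mesh (N : nat) : R := 2 / N%:R.
Definition knot (m N : nat) (i : nat) : R :=
  -1 + mesh N * (minn N (i - m.-1))%:R.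

Definition dimS (m N : nat) : nat := (N + m).-1.

Definition Bsp (m N j : nat) (x : R) : R := bspl (knot m N) m.-1 j x.

(* basis function of V^m_{kappa,h} with block index p (eps_p = p-1) and
   spline index l : B_l e^{i eps_p kappa x} *)
Definition phi (m N : nat) (kappa : R) (p l : nat) (x : R) : R[i] :=
  (Bsp m N l x)%:C%C * expi ((p%:R - 1) * kappa * x).

Definition Ed (m N : nat) (kappa : R) : 'M[R[i]]_(3 * dimS m N) :=
  \matrix_(k, k') ip (phi m N kappa (k %/ dimS m N) (k %% dimS m N))
                     (phi m N kappa (k' %/ dimS m N) (k' %% dimS m N)).

Definition Kd (K : R -> R -> R[i]) (m N : nat) (kappa : R) :
  'M[R[i]]_(3 * dimS m N) :=
  \matrix_(k, k') ip (Kop K kappa (phi m N kappa (k %/ dimS m N) (k %% dimS m N)))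
                     (phi m N kappa (k' %/ dimS m N) (k' %% dimS m N)).

Definition vnorm n (x : 'cV[R[i]]_n) : R :=
  Num.sqrt (\sum_i (Normc.normc (x i 0)) ^+ 2).

Definition opnorm n (A : 'M[R[i]]_n) : R :=
  sup [set r : R | exists x : 'cV[R[i]]_n, vnorm x = 1 /\ r = vnorm (A *m x)].

Definition Cond n (A : 'M[R[i]]_n) : \bar R :=
  if A \in unitmx then (opnorm A * opnorm (invmx A))%:E else +oo%E.

End Defs.

(* Main.v *)
From HB Require Import structures.
Require Import Defs.
From mathcomp Require Import all_boot all_order all_algebra.
From mathcomp Require Import all_classical all_reals all_analysis.
From mathcomp Require Import measurable_realfun complex polyrcf.
From mathcomp Require Import ring lra zify.
Set Implicit Arguments.
Unset Strict Implicit.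
Unset Printing Implicit Defensive.
Import Order.TTheory GRing.Theory Num.Theory.
Import numFieldNormedType.Exports.
Local Open Scope classical_set_scope.
Local Open Scope ring_scope.

(* For a fixed mesh, the Riemann-Lebesgue lemma shows that the matrix converges,
   as [kappa -> +oo], to a block diagonal matrix whose blocks are [G - V^-], [G]
   and [G - V^+]: [G] is the Gram matrix of the B-splines, and [V^+], [V^-] are
   the Galerkin matrices of the Volterra operators with kernel [K] on [t <= s]
   and on [t > s], the only two regions where the phase cancels.  By the L^2
   stability of B-splines, [G >= c h].  Conjugating by the diagonal weights
   [(1 + lambda h)^l] (or their inverses) moves [G] by [O(h^2)] only, while the
   nearly triangular matrix [V] becomes exponentially decaying away from the
   diagonal, with norm [O(h / lambda)]; so for [lambda] large and [h] small the
   limit matrix is bounded below by a multiple of [h], and it is bounded above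
   by a multiple of [h]. *)

(** * B-splines: support, Marsden's identity and L^2 stability *)

(** [V] cannot be absorbed as a small perturbation: its entries are O(h^2), but a row holds of the
    order of 1/h of them, so its norm is O(h) like that of [G], with a constant governed by [K].
    What makes [G - V] invertible is that Volterra operators are quasi-nilpotent. The weights are
    the discrete form of the norm weighted by exp(lambda s), in which such an operator has norm
    O(1/lambda); the two blocks carry opposite weights because their operators integrate in opposite
    directions. The dimension is at most a multiple of 1/h, so the weights stay between constants
    exp(-C lambda) and exp(C lambda), and the conjugation costs a factor independent of the mesh.
    Riemann-Lebesgue and dominated convergence give no rate in kappa. For a fixed mesh there are
    finitely many entries, which can be brought within any tolerance of their limits, here a
    multiple of h over the dimension; this is why kappa_0 is chosen after h, while the estimates of
    the limit matrix are uniform in h. Splines of order 1 and kernels cut along the diagonal are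
    discontinuous, hence the work with bounded measurable functions. *)

Lemma bspl_affine (R : realType) (t u : nat -> R) (c h : R) (n i : nat) (x : R) :
  0 < h -> (forall i, t i = c + h * u i) ->
  bspl t n i (c + h * x) = bspl u n i x.
Proof.
move=> h0 tE; elim: n i => [|n IH] i /=.
  by rewrite !tE lerD2l ltrD2l ler_pM2l// ltr_pM2l.
(* Valid for [d = e] too, where both sides are 0, so repeated knots need no separate case. *)
have q (a b d e : R) : (c + h * a - (c + h * b)) / (c + h * d - (c + h * e)) =
    (a - b) / (d - e).
  have r x1 x2 : c + h * x1 - (c + h * x2) = h * (x1 - x2) by ring.
  by rewrite !r invfM mulrACA divff ?mul1r// gt_eqF.
by rewrite !IH !tE !q.
Qed.

Lemma bspl_support (R : realType) (t : nat -> R) (n i : nat) (x : R) :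
  {homo t : i j / (i <= j)%N >-> i <= j} ->
  bspl t n i x != 0 -> t i <= x < t (i + n.+1)%N.
Proof.
move=> tm; elim: n i => [|n IH] i /=.
  by case: ifP => [|_]; rewrite ?addn1// eqxx.
case: (eqVneq (bspl t n i x) 0) => [->|/IH /andP[h1 h2] _].
  rewrite mulr0 add0r; case: (eqVneq (bspl t n i.+1 x) 0) => [->|].
    by rewrite mulr0 eqxx.
  move=> /IH /andP[h1 h2] _; apply/andP; split.
    by apply: le_trans h1; apply: tm.
  by rewrite -addSnnS.
rewrite h1 /=; apply: lt_le_trans h2 _; apply: tm; lia.
Qed.

(** On the support of the B-spline that it multiplies, each weight of the recursion lies in [0, 1],
    so the bound at most doubles with each degree. *)
Lemma bspl_le (R : realType) (t : nat -> R) (n i : nat) (x : R) :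
  {homo t : i j / (i <= j)%N >-> i <= j} -> `|bspl t n i x| <= 2 ^+ n.
Proof.
move=> tm; elim: n i => [|n IH] i /=.
  by case: ifP; rewrite ?normr1 ?normr0 ?expr0.
have key (a b : R) j : (bspl t n j x != 0 -> 0 <= a <= b) ->
    `|a / b * bspl t n j x| <= 2 ^+ n.
  case: (eqVneq (bspl t n j x) 0) => [-> _|_ /(_ isT) /andP[a0 ab]].
    by rewrite mulr0 normr0 exprn_ge0.
  have b0 : 0 <= b by exact: le_trans ab.
  rewrite normrM -[leRHS]mul1r ler_pM// ger0_norm ?divr_ge0//.
  have [->|bn0] := eqVneq b 0; first by rewrite invr0 mulr0.
  by rewrite ler_pdivrMr ?mul1r// lt_def bn0.
rewrite (_ : 2 ^+ n.+1 = 2 ^+ n + 2 ^+ n); last by rewrite exprS; ring.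
apply: le_trans (ler_normD _ _) _.
apply: lerD; apply: key => /(bspl_support tm) /andP[].
  by move=> h1 h2; apply/andP; split; lra.
rewrite addSnnS => h1 h2; apply/andP; split; lra.
Qed.

Lemma measurable_bspl (R : realType) (t : nat -> R) (n i : nat) :
  measurable_fun setT (bspl t n i).
Proof.
elim: n i => [|n IH] i.
  rewrite (_ : bspl _ _ _ = \1_(`[t i, t i.+1[%classic : set R)).
    exact: measurable_indic.
  apply/funext => x /=; rewrite indicE mem_setE /= in_itv /=.
  by case: ifP.
apply: measurable_funD; apply: measurable_funM => //;
  apply: measurable_funM => //; exact: measurable_funB.
Qed.

Lemma bspl_piecewise_poly (R : realType) (t : nat -> R) (I n i : nat) :
  {homo t : i j / (i <= j)%N >-> i <= j} ->
  exists p : {poly R}, (size p <= n.+1)%N /\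
    forall x : R, t I <= x < t I.+1 -> bspl t n i x = p.[x].
Proof.
move=> tm; elim: n i => [|n IH] i.
  exists (if i == I then 1 else 0); split.
    by case: ifP => _; [rewrite size_poly1 | rewrite size_poly0].
  move=> x /andP[x1 x2] /=; case: (ltngtP i I) => iI.
  - rewrite horner0 ltNge (le_trans (tm _ _ iI) x1) andbF //.
  - by rewrite horner0 leNgt (lt_le_trans x2 (tm _ _ iI)).
  - by rewrite iI x1 x2 hornerC.
have [p [sp pE]] := IH i; have [q [sq qE]] := IH i.+1.
set a := (t (i + n.+1)%N - t i)^-1; set b := (t (i + n.+2)%N - t i.+1)^-1.
exists ((a *: ('X - (t i)%:P)) * p - (b *: ('X - (t (i + n.+2)%N)%:P)) * q); split.
  have sz c d (r : {poly R}) : (size r <= n.+1)%N ->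
      (size (c *: ('X - d%:P) * r)%R <= n.+2)%N.
    move=> sr; apply: leq_trans (size_polyMleq _ _) _.
    have := size_scale_leq c ('X - d%:P); rewrite size_XsubC => sc.
    have : (size (c *: ('X - d%:P)) + size r <= 2 + n.+1)%N by exact: leq_add.
    by case: (_ + _)%N.
  rewrite (leq_trans (size_polyD _ _))// size_polyN geq_max !sz//.
move=> x xI /=; rewrite (pE _ xI) (qE _ xI) !hornerE -/a -/b; ring.
Qed.

(* Stated as a polynomial identity in the dual variable, so that comparing
   coefficients expresses each monomial through the local B-splines. *)
Lemma marsden (R : realType) (t : nat -> R) (n k : nat) (x : R) :
  {homo t : i j / (i <= j)%N >-> i <= j} ->
  t (k + n)%N <= x < t (k + n).+1 ->
  ('X - x%:P) ^+ n =
  \sum_(i < n.+1) bspl t n (k + i) x *: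
     \prod_(r < n) ('X - (t (k + i + r.+1)%N)%:P).
Proof.
move=> tm; elim: n k => [|n IH] k xk.
  rewrite big_ord1 big_ord0 expr0 /= !addn0 in xk *.
  by rewrite xk scale1r.
have xk' : t (k.+1 + n)%N <= x < t (k.+1 + n).+1 by rewrite addSnnS.
have {}IH := IH _ xk'; case/andP: xk => xk1 xk2.
rewrite exprSr IH.
pose psi n i := \prod_(r < n) ('X - (t (k + i + r.+1)%N)%:P).
pose al i := (x - t (k + i)%N) / (t (k + i + n.+1)%N - t (k + i)%N).
pose be i := (t (k + i + n.+1)%N - x) / (t (k + i + n.+1)%N - t (k + i)%N).
transitivity (\sum_(i < n.+2) (al i * bspl t n (k + i) x) *: psi n.+1 i +
  \sum_(i < n.+2) (be i.+1 * bspl t n (k + i.+1) x) *: psi n.+1 i); last first.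
  rewrite -big_split /=; apply: eq_bigr => i _; rewrite -scalerDl.
  congr (_ *: _); rewrite /al /be !addnS.
  by rewrite !addSn.
rewrite [X in _ = X + _]big_ord_recl [X in _ = _ + X]big_ord_recr /=.
rewrite (_ : bspl t n (k + 0) x = 0); last first.
  apply/eqP/negPn/negP => /(bspl_support tm) /andP[_].
  by rewrite addn0 ltNge xk1.
rewrite (_ : bspl t n (k + n.+2) x = 0); last first.
  apply/eqP/negPn/negP => /(bspl_support tm) /andP[].
  by rewrite addnS leNgt xk2.
rewrite !mulr0 !scale0r add0r addr0 -big_split /= mulr_suml.
apply: eq_bigr => i _.
rewrite /bump /= add1n.
have e : (k.+1 + i = k + i.+1)%N by rewrite addSnnS.
(* The cell containing [x], which has positive length, lies between these two knots. *)
have nz : t (k + i.+1 + n.+1)%N - t (k + i.+1)%N != 0.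
  rewrite subr_eq0 gt_eqF//.
  apply: le_lt_trans (_ : t (k + n.+1)%N < _).
    by apply: tm; have := ltn_ord i; lia.
  apply: le_lt_trans xk1 (lt_le_trans xk2 _); apply: tm; lia.
have psi1 : psi n.+1 i.+1 = psi n i.+1 * ('X - (t (k + i.+1 + n.+1)%N)%:P).
  by rewrite /psi big_ord_recr.
have psi2 : psi n.+1 i = ('X - (t (k + i.+1)%N)%:P) * psi n i.+1.
  rewrite /psi big_ord_recl /= addn1 addnS; congr (_ * _).
  by apply: eq_bigr => r _; rewrite /bump /= add1n !addnS addSn.
rewrite e -/(psi n i.+1) psi1 psi2.
rewrite /al /be.
set p := t (k + i.+1)%N in nz *; set q := t _ in nz *.
set b := bspl _ _ _ _; set s := psi _ _.
(* [x] is an affine combination of [p] and [q], so ['X - x] is the same combination of ['X - p] and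
   ['X - q], the two factors that extend [s] to the neighbouring products of higher degree. *)
have e1 : (q - x) / (q - p) = 1 - (x - p) / (q - p) by field.
have e2 : p + (x - p) / (q - p) * (q - p) = x by field.
rewrite e1; set a := _ / _ in e2 *.
rewrite -[in LHS]e2 -!mul_polyC !polyCM !polyCD !polyCN !polyCM !polyCD !polyCN.
ring.
Qed.

(** * Integration of polynomials over [0, 1] *)

Definition poly_prim (R : realType) (p : {poly R}) : {poly R} :=
  \poly_(i < (size p).+1) (p`_i.-1 / i%:R).

Lemma deriv_poly_prim (R : realType) (p : {poly R}) : (poly_prim p)^`() = p.
Proof.
apply/polyP => i; rewrite coef_deriv coef_poly /= ltnS.
case: ltnP => ip; last by rewrite nth_default// mul0rn.
by rewrite -[LHS]mulr_natr mulfVK// pnatr_eq0.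
Qed.

(** The constant coefficient is a quotient by 0, which is 0 by convention. *)
Lemma horner0_poly_prim (R : realType) (p : {poly R}) : (poly_prim p).[0] = 0.
Proof. by rewrite horner_coef0 coef_poly invr0 mulr0. Qed.

(** The integral over [0, 1], taken algebraically so that the comparison of coefficients with the
    L^2 norm is plain linear algebra; [Rintegral_cell_poly] links it to the Lebesgue integral. *)
Definition poly_int (R : realType) (p : {poly R}) : R := (poly_prim p).[1].

Lemma poly_int_is_linear (R : realType) : scalar (@poly_int R).
Proof.
move=> a p q; rewrite /poly_int.
suff -> : poly_prim (a *: p + q) = a *: poly_prim p + poly_prim q.
  by rewrite hornerD hornerZ.
have pE (r : {poly R}) i : (poly_prim r)`_i = r`_i.-1 / i%:R.
  rewrite coef_poly; case: ltnP => // ir; case: i ir => [|i] ir.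
    by rewrite invr0 mulr0.
  by rewrite nth_default ?mul0r.
by apply/polyP => i; rewrite coefD coefZ !pE coefD coefZ mulrDl mulrA.
Qed.

HB.instance Definition _ (R : realType) := GRing.isLinear.Build R {poly R} R *%R
  (@poly_int R) (@poly_int_is_linear R).

Lemma poly_eq_on_itv01 (R : realType) (p q : {poly R}) :
  (forall x : R, 0 <= x < 1 -> p.[x] = q.[x]) -> p = q.
Proof.
move=> pq; apply/eqP; rewrite -subr_eq0; apply/negPn/negP => nz.
(* Distinct points of [0, 1[, one more than the degree of [p - q]. *)
pose s := [seq (i.+2%:R : R)^-1 | i <- iota 0 (size (p - q))].
have := @max_poly_roots R (p - q) s nz; rewrite size_map size_iota ltnn.
suff [-> ->] : all (root (p - q)) s /\ uniq s by move/(_ isT isT).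
split.
  apply/allP => _ /mapP[i _ ->]; rewrite rootE hornerD hornerN pq ?subrr//.
  by rewrite invr_ge0 ler0n /= invf_lt1// ltr1n.
rewrite map_inj_uniq ?iota_uniq// => i j /invr_inj /eqP.
by rewrite eqr_nat => /eqP[].
Qed.

Lemma poly_int_sqr_ge0 (R : realType) (p : {poly R}) : 0 <= poly_int (p ^+ 2).
Proof.
have [c _ /=] := poly_mvt (poly_prim (p ^+ 2)) (@ltr01 R).
rewrite horner0_poly_prim deriv_poly_prim !subr0 mulr1 /poly_int => ->.
by rewrite horner_exp sqr_ge0.
Qed.

(** The primitive of [p ^+ 2] is nondecreasing and vanishes at 0 and at 1, hence on all of [0, 1[;
    it is then the zero polynomial, and so is its derivative. *)
Lemma poly_int_sqr_eq0 (R : realType) (p : {poly R}) :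
  poly_int (p ^+ 2) = 0 -> p = 0.
Proof.
rewrite /poly_int; set P := poly_prim _ => P1.
have P0 : P.[0] = 0 by exact: horner0_poly_prim.
have incr (a b : R) : a < b -> P.[a] <= P.[b].
  move=> ab; have [c _] := poly_mvt P ab.
  rewrite deriv_poly_prim horner_exp => /eqP; rewrite subr_eq => /eqP ->.
  by rewrite lerDr mulr_ge0 ?sqr_ge0// subr_ge0 ltW.
suff : P = 0.
  move=> PE; have := deriv_poly_prim (p ^+ 2); rewrite -/P PE deriv0.
  by move/esym/eqP; rewrite expf_eq0 /= => /eqP.
apply: poly_eq_on_itv01 => x /andP[x0 x1]; rewrite horner0; apply/eqP.
rewrite eq_le -{1}P1 incr//=.
by have [<-|xn0] := eqVneq 0 x; rewrite -[leLHS]P0// incr// lt_neqAle xn0.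
Qed.

Lemma poly_int_CS (R : realType) (p q : {poly R}) :
  poly_int (p * q) ^+ 2 <= poly_int (p ^+ 2) * poly_int (q ^+ 2).
Proof.
have [/eqP q0|q0] := boolP (poly_int (q ^+ 2) == 0).
  by rewrite (poly_int_sqr_eq0 q0) mulr0 !expr0n/= !linear0 mulr0 expr0n.
have {}q0 : 0 < poly_int (q ^+ 2) by rewrite lt_def q0 poly_int_sqr_ge0.
set A := poly_int (p * q); set B := poly_int (q ^+ 2) in q0 *.
have := poly_int_sqr_ge0 (B *: p - A *: q).
pose D := - (2 * A * B).
have -> : (B *: p - A *: q) ^+ 2 =
    B ^+ 2 *: p ^+ 2 + D *: (p * q) + A ^+ 2 *: q ^+ 2.
  by rewrite /D -!mul_polyC !(polyCN, polyCM, rmorphXn) /=; ring.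
rewrite !linearD !linearZ /= -/A -/B; set C := poly_int (p ^+ 2).
have -> : B ^+ 2 * C + D * A + A ^+ 2 * B = B * (C * B - A ^+ 2) by rewrite /D; ring.
by rewrite pmulr_rge0// subr_ge0.
Qed.

(** Equivalence of norms in finite dimension, made explicit through the Gram matrix [H] of the
    monomials (the Hilbert matrix): definiteness makes it invertible, and its inverse recovers the
    coefficients of [p] from its moments. *)
Lemma coef_le_poly_int (R : realType) (n : nat) : exists2 C : R, 0 < C &
  forall p : {poly R}, (size p <= n)%N ->
    forall s, p`_s ^+ 2 <= C * poly_int (p ^+ 2).
Proof.
pose H := \matrix_(r < n, s < n) poly_int ('X^r * 'X^s : {poly R}).
have pE (p : {poly R}) : (size p <= n)%N -> p = \sum_(i < n) p`_i *: 'X^i.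
  move=> sp; rewrite -poly_def; apply/polyP => i; rewrite coef_poly.
  by case: ltnP => // ni; rewrite nth_default// (leq_trans sp).
have Hmul (p : {poly R}) : (size p <= n)%N ->
    (\row_(i < n) p`_i) *m H = \row_(s < n) poly_int (p * 'X^s).
  move=> sp; apply/rowP => s; rewrite !mxE {2}(pE _ sp) mulr_suml linear_sum.
  by apply: eq_bigr => i _; rewrite !mxE -scalerAl linearZ.
have uH : H \in unitmx.
  rewrite -row_free_unit; apply: inj_row_free => v vH.
  pose p := \poly_(i < n) (if insub i is Some j then v 0 j else 0).
  have vE : v = \row_(i < n) p`_i.
    apply/rowP => j; rewrite mxE coef_poly ltn_ord; case: insubP => [k _ kj|].
      by congr (v _ _); apply: val_inj.
    by rewrite ltn_ord.
  have sp : (size p <= n)%N by exact: size_poly.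
  have : poly_int (p ^+ 2) = 0.
    rewrite expr2 {2}(pE _ sp) mulr_sumr linear_sum big1// => i _.
    rewrite -scalerAr linearZ /=.
    have /rowP/(_ i) : \row_(s < n) poly_int (p * 'X^s) = 0.
      by rewrite -Hmul// -vE.
    by rewrite !mxE => ->; rewrite mulr0.
  move/poly_int_sqr_eq0 => p0; rewrite vE p0; apply/rowP => i.
  by rewrite !mxE coef0.
(* Cauchy-Schwarz bounds the moment of order [r] by the norms of [p] and of ['X^r]; the matrix
   [invmx H] turns these bounds into one for the coefficient of index [s]. *)
pose M s := \sum_(r < n) `|invmx H r s| * Num.sqrt (poly_int ('X^r ^+ 2 : {poly R})).
pose C := 1 + \sum_(s < n) (M s) ^+ 2.
have C0 : 0 < C by rewrite ltr_pwDl// sumr_ge0// => s _; exact: sqr_ge0.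
exists C => // p sp s; case: (ltnP s n) => sn; last first.
  rewrite nth_default ?(leq_trans sp)// expr0n /=.
  by rewrite mulr_ge0 ?poly_int_sqr_ge0// ltW.
have L0 := poly_int_sqr_ge0 p.
suff : `|p`_s| <= M (Ordinal sn) * Num.sqrt (poly_int (p ^+ 2)).
  move=> h; rewrite -[p`_s ^+ 2]real_normK ?num_real//.
  apply: le_trans (_ : (M (Ordinal sn) * Num.sqrt (poly_int (p ^+ 2))) ^+ 2 <= _).
    by rewrite lerXn2r// nnegrE// (le_trans _ h).
  rewrite exprMn sqr_sqrtr// ler_wpM2r// /C (bigD1 (Ordinal sn)) //=.
  rewrite addrCA lerDl addr_ge0// sumr_ge0// => i _; exact: sqr_ge0.
have /rowP/(_ (Ordinal sn)) : \row_(i < n) p`_i =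
    (\row_(s < n) poly_int (p * 'X^s)) *m invmx H by rewrite -Hmul// mulmxK.
rewrite !mxE /= => ->; apply: le_trans (ler_norm_sum _ _ _) _.
rewrite /M mulr_suml; apply: ler_sum => r _; rewrite !mxE normrM -mulrA [leLHS]mulrC.
apply: ler_wpM2l => //; rewrite [leRHS]mulrC -sqrtrM// -sqrtr_sqr.
by apply: ler_wsqrtr; exact: poly_int_CS.
Qed.

(** * Local stability of the B-splines on the reference cell *)

Lemma coef_XsubC_exp (R : realType) (x : R) (n s : nat) : (s <= n)%N ->
  (('X - x%:P) ^+ n)`_(n - s) = (- x) ^+ s *+ 'C(n, s).
Proof.
move=> sn.
have -> : ('X - x%:P) ^+ n =
    \sum_(i < n.+1) ((- x) ^+ i *+ 'C(n, i)) *: 'X^(n - i) :> {poly R}.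
  rewrite exprDn; apply: eq_bigr => i _.
  by rewrite -polyCN -rmorphXn /= mulrC mul_polyC scalerMnl.
rewrite coef_sum (bigD1 (Ordinal (sn : s < n.+1)%N)) //= coefZ coefXn eqxx mulr1.
rewrite big1 ?addr0// => i /negP ine; rewrite coefZ coefXn.
case: eqP => [e|]; last by rewrite mulr0.
case: ine; apply/eqP/val_inj => /=; have := ltn_ord i; lia.
Qed.

(** The coefficients are dominated by those of [('X + b)^n], which add up to [(1 + b)^n]. *)
Lemma coef_prod_XsubC_le (R : realType) (n : nat) (c : nat -> R) (b : R) :
  0 <= b -> (forall r, (r < n)%N -> `|c r| <= b) ->
  forall s, `|(\prod_(r < n) ('X - (c r)%:P))`_s| <= (1 + b) ^+ n.
Proof.
move=> b0; elim: n => [|n IH] cb s.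
  by rewrite big_ord0 expr0 coef1; case: eqP; rewrite ?normr1 ?normr0.
have {}IH := IH (fun r h => cb r (ltnW h)).
rewrite big_ord_recr /= mulrBr coefB coefMX coefMC exprSr mulrDr mulr1.
apply: le_trans (ler_normB _ _) _; apply: lerD.
  by case: eqP => _ //; rewrite normr0 exprn_ge0// addr_ge0.
by rewrite normrM ler_pM// cb.
Qed.

(* Let [P] hold the coefficients of the [n + 1] B-splines alive on [0, 1[.
   Marsden's identity provides a matrix [C] with bounded entries and
   [C P = 1]; then [P C = 1] recovers the B-spline coefficients of a spline from
   the monomial coefficients of its local polynomial. *)
Lemma bspl_local_stable (R : realType) (n : nat) : exists2 C : R, 0 < C &
  forall (t : nat -> R) (k : nat), {homo t : i j / (i <= j)%N >-> i <= j} ->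
  t (k + n)%N = 0 -> t (k + n).+1 = 1 ->
  (forall r, (k < r <= k + n + n)%N -> `|t r| <= n%:R) ->
  forall a : nat -> R, exists p : {poly R},
    (forall x : R, 0 <= x < 1 ->
       \sum_(i < n.+1) a i * bspl t n (k + i) x = p.[x]) /\
    forall i, (i <= n)%N -> a i ^+ 2 <= C * poly_int (p ^+ 2).
Proof.
have [C0 C0gt hC0] := @coef_le_poly_int R n.+1.
pose b : R := (1 + n%:R) ^+ n.
pose D : R := n.+1%:R * b.
have b1 : 1 <= b by rewrite exprn_ege1// lerDl.
exists (D ^+ 2 * C0).
  by rewrite mulr_gt0// exprn_gt0// mulr_gt0// (lt_le_trans ltr01).
move=> t k tm t0 t1 tb a.
have /choice[P hP] : forall i, exists p : {poly R}, (size p <= n.+1)%N /\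
    forall x : R, 0 <= x < 1 -> bspl t n (k + i) x = p.[x].
  by move=> i; have := bspl_piecewise_poly (k + n) n (k + i) tm; rewrite t0 t1.
pose psi i := \prod_(r < n) ('X - (t (k + i + r.+1)%N)%:P).
(* Comparing the coefficients of degree [n - s] in Marsden's identity leaves [(-x)^s] times a
   binomial coefficient on one side; solved for [x^s], it makes [c s i] the coefficient of the
   [i]-th B-spline in this monomial. *)
pose c (s i : nat) : R := (-1) ^+ s / 'C(n, s)%:R * (psi i)`_(n - s).
have cb s i : (s <= n)%N -> (i <= n)%N -> `|c s i| <= b.
  move=> sn ini; rewrite /c normrM -[leRHS]mul1r; apply: ler_pM => //.
    rewrite normrM normrX normrN1 expr1n mul1r normfV.
    rewrite invf_le1 ?normr_gt0 ?pnatr_eq0 ?lt0n_neq0 ?bin_gt0//.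
    by rewrite normr_nat ler1n bin_gt0.
  apply: (@coef_prod_XsubC_le R n (fun r => t (k + i + r.+1)%N) n%:R) => // r rn; apply: tb; lia.
have cP (s : nat) : (s <= n)%N -> \sum_(i < n.+1) c s i *: P i = 'X^s.
  move=> sn; apply: poly_eq_on_itv01 => x x01; rewrite horner_sum hornerXn.
  have := @marsden R t n k x tm; rewrite t0 t1 => /(_ x01).
  move/(congr1 (fun p : {poly R} => p`_(n - s))).
  rewrite coef_XsubC_exp// coef_sum => e.
  rewrite (eq_bigr (fun i : 'I_n.+1 => (-1) ^+ s / 'C(n, s)%:R *
    (bspl t n (k + i) x *: psi i)`_(n - s))); last first.
    by move=> i _; rewrite hornerZ -(hP i).2// coefZ /c; ring.
  rewrite -mulr_sumr -e -[(- x) ^+ s *+ _]mulr_natr (exprNn x).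
  have nz : ('C(n, s)%:R : R) != 0 by rewrite pnatr_eq0 -lt0n bin_gt0.
  have e1 : (-1) ^+ s * (-1) ^+ s = 1 :> R by rewrite -expr2 sqrr_sign.
  transitivity ((-1) ^+ s * (-1) ^+ s * ('C(n, s)%:R / 'C(n, s)%:R) * x ^+ s).
    move: ((-1) ^+ s) (x ^+ s) ('C(n, s)%:R : R) => y1 y2 y3; ring.
  by rewrite e1 divff// !mul1r.
pose Cm := \matrix_(s < n.+1, i < n.+1) c s i.
pose Pm := \matrix_(i < n.+1, s < n.+1) (P i)`_s.
have CP : Cm *m Pm = 1%:M.
  apply/matrixP => s s'; rewrite !mxE.
  have := congr1 (fun p : {poly R} => p`_s') (cP s (ltn_ord s)).
  rewrite coef_sum coefXn => e.
  rewrite (eq_bigr (fun i : 'I_n.+1 => (c s i *: P i)`_s')).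
    by rewrite e -val_eqE eq_sym.
  by move=> i _; rewrite !mxE coefZ.
have PC := mulmx1C CP.
pose p := \sum_(i < n.+1) a i *: P i.
have sp : (size p <= n.+1)%N.
  apply: leq_trans (size_sum _ _ _) _; apply/bigmax_leqP => i _.
  exact: leq_trans (size_scale_leq _ _) (hP i).1.
exists p; split=> [x x01|i ini].
  rewrite horner_sum; apply: eq_bigr => i _.
  by rewrite hornerZ (hP i).2.
have aE : a i = \sum_(s < n.+1) p`_s * c s i.
  pose av := \row_(i < n.+1) a i.
  have := congr1 (fun v : 'rV_n.+1 => v 0 (inord i)) (mulmx1 av).
  rewrite -PC mulmxA !mxE inordK// => <-; apply: eq_bigr => s _.
  rewrite !mxE inordK//; congr (_ * _); rewrite coef_sum.
  by apply: eq_bigr => j _; rewrite !mxE coefZ.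
have L0 := poly_int_sqr_ge0 p.
have ps s : `|p`_s| <= Num.sqrt (C0 * poly_int (p ^+ 2)).
  rewrite -sqrtr_sqr; apply: ler_wsqrtr; exact: hC0.
have : `|a i| <= D * Num.sqrt (C0 * poly_int (p ^+ 2)).
  rewrite aE; apply: le_trans (ler_norm_sum _ _ _) _.
  apply: le_trans (_ : \sum_(s < n.+1) b * Num.sqrt (C0 * poly_int (p ^+ 2)) <= _).
    apply: ler_sum => s _; rewrite normrM mulrC ler_pM//; apply: cb => //.
    exact: ltn_ord s.
  by rewrite sumr_const card_ord -[leLHS]mulr_natl mulrA.
move=> h; rewrite -[a i ^+ 2]real_normK ?num_real//.
apply: le_trans (_ : (D * Num.sqrt (C0 * poly_int (p ^+ 2))) ^+ 2 <= _).
  by rewrite lerXn2r// nnegrE// (le_trans _ h).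
by rewrite exprMn sqr_sqrtr ?mulr_ge0// ?mulrA// ltW.
Qed.

(** * From the reference cell to the whole interval *)

Lemma Rintegral_cell_poly (R : realType) (p : {poly R}) (a h : R) : 0 < h ->
  \int[@lebesgue_measure R]_(x in `[a, a + h]) p.[(x - a) / h] = h * poly_int p.
Proof.
move=> h0.
pose g : {poly R} := h^-1 *: ('X - a%:P).
have gE x : g.[x] = (x - a) / h by rewrite /g hornerZ !hornerE mulrC.
pose F : {poly R} := h *: (poly_prim p \Po g).
have F' : F^`() = p \Po g.
  rewrite derivZ deriv_comp deriv_poly_prim derivZ derivXsubC.
  by rewrite -scalerAr mulr1 scalerA mulfV ?scale1r// gt_eqF.
rewrite /Rintegral; under eq_integral do rewrite -gE -horner_comp.
rewrite (@continuous_FTC2 _ _ (horner F)) ?ltrDl//=.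
- rewrite !hornerZ !horner_comp !gE subrr mul0r horner0_poly_prim mulr0 subr0.
  by rewrite addrAC subrr add0r divff ?gt_eqF.
- by apply: continuous_subspaceT => x; exact: continuous_horner.
- split; first by move=> x _; exact: derivable_horner.
  + by apply: cvg_at_right_filter; exact: continuous_horner.
  + by apply: cvg_at_left_filter; exact: continuous_horner.
- by move=> x _; rewrite derive1E -F'; apply: derive_val.
Qed.

Lemma integrable_bounded (R : realType) (f : R -> R) (D : set R) (M : R) :
  measurable D -> D `<=` `[-1, 1]%classic ->
  measurable_fun setT f -> (forall x, inI x -> `|f x| <= M) ->
  (@lebesgue_measure R).-integrable D (EFin \o f).
Proof.
move=> mD D1 mf fM.
have h : (@lebesgue_measure R).-integrable `[-1, 1]%classic (EFin \o f).
  apply: measurable_bounded_integrable => //.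
  - by rewrite /= lebesgue_measure_itv /= lte_fin; case: ifP; rewrite // ltry.
  - exact: measurable_funTS.
  exists M; split; first exact: num_real.
  move=> y My x /=; rewrite in_itv /= => xI.
  by apply: le_trans (fM _ xI) (ltW My).
exact: integrableS h.
Qed.

Lemma Rintegral_split (R : realType) (f : R -> R) (a b c M : R) :
  -1 <= a -> a <= b -> b <= c -> c <= 1 ->
  measurable_fun setT f -> (forall x, inI x -> `|f x| <= M) ->
  \int[@lebesgue_measure R]_(x in `[a, c]) f x =
  \int[@lebesgue_measure R]_(x in `[a, b]) f x +
  \int[@lebesgue_measure R]_(x in `[b, c]) f x.
Proof.
move=> a1 ab bc c1 mf fM.
have int (u v : itv_bound R) : (BLeft (-1) <= u)%O -> (v <= BRight 1)%O ->
    (@lebesgue_measure R).-integrable [set` Interval u v] (EFin \o f).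
  move=> hu hv; apply: (integrable_bounded _ _ mf fM) => //.
  by apply: subset_itv.
apply/eqP; rewrite addrC -subr_eq; apply/eqP.
rewrite Rintegral_itvB ?bnd_simp//; last by apply: int; rewrite bnd_simp.
by rewrite Rintegral_itv_obnd_cbnd//; apply: int; rewrite bnd_simp// (le_trans a1).
Qed.

Lemma knot_homo (R : realType) (m N : nat) :
  {homo knot R m N : i j / (i <= j)%N >-> i <= j}.
Proof.
move=> i j ij; rewrite /knot lerD2l ler_wpM2l ?divr_ge0// ler_nat.
by rewrite leq_min !geq_min leqnn leq_sub2r// orbT.
Qed.

Lemma mesh_gt0 (R : realType) (N : nat) : (0 < N)%N -> 0 < mesh R N.
Proof. by move=> N0; rewrite divr_gt0 ?ltr0n. Qed.

Definition spline (R : realType) (m N : nat) (a : nat -> R) (x : R) : R :=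
  \sum_(l < dimS m N) a l * Bsp m N l x.

Lemma measurable_Bsp (R : realType) (m N l : nat) :
  measurable_fun setT (@Bsp R m N l).
Proof. exact: measurable_bspl. Qed.

Lemma measurable_spline (R : realType) (m N : nat) (a : nat -> R) :
  measurable_fun setT (spline m N a).
Proof.
apply: measurable_sum => l; apply: measurable_funM => //.
exact: measurable_Bsp.
Qed.

Lemma spline_cell (R : realType) (n N k : nat) (a : nat -> R) (x : R) :
  (k < N)%N -> -1 + mesh R N * k%:R <= x < -1 + mesh R N * k.+1%:R ->
  spline n.+1 N a x = \sum_(i < n.+1) a (k + i)%N * Bsp n.+1 N (k + i) x.
Proof.
move=> kN /andP[xk1 xk2]; rewrite /spline.
have N0 : (0 < N)%N by lia.
have h0 := mesh_gt0 R N0.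
have nz l : Bsp n.+1 N l x != 0 -> (k <= l)%N /\ (l <= k + n)%N.
  move=> /(bspl_support (@knot_homo _ _ _)) /andP[x1 x2].
  rewrite /knot /= in x1 x2.
  have := le_lt_trans x1 xk2; have := le_lt_trans xk1 x2.
  rewrite !ltrD2l !ltr_pM2l// !ltr_nat; lia.
rewrite -(big_mkord xpredT (fun l => a l * Bsp n.+1 N l x)).
rewrite (@big_cat_nat _ _ _ k)//=; last by rewrite /dimS; lia.
rewrite big_nat big1 ?add0r; last first.
  move=> l /andP[_ lk]; have [->|/nz] := eqVneq (Bsp n.+1 N l x) 0.
    by rewrite mulr0.
  lia.
rewrite (@big_cat_nat _ _ _ (k + n.+1)%N)//=; [|lia|rewrite /dimS; lia].
rewrite [X in _ + X]big_nat [X in _ + X]big1 ?addr0; last first.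
  move=> l /andP[lk _]; have [->|/nz] := eqVneq (Bsp n.+1 N l x) 0.
    by rewrite mulr0.
  lia.
by rewrite -{1}[k]add0n big_addn addKn big_mkord; apply: eq_bigr => i _; rewrite addnC.
Qed.

(** Every index below [N + n] has the form [k + i] for at least one cell [k], so the local sums miss
    no term. *)
Lemma sum_cells_ge (R : realType) (n N : nat) (f : nat -> R) : (0 < N)%N ->
  (forall l, 0 <= f l) ->
  \sum_(l < N + n) f l <= \sum_(k < N) \sum_(i < n.+1) f (k + i)%N.
Proof.
move=> + f0; case: N => // N _; elim: N => [|N IH].
  by rewrite big_ord1 add1n.
rewrite addSn big_ord_recr [leRHS]big_ord_recr /= lerD// big_ord_recr /=.
rewrite lerDr.
by rewrite sumr_ge0.
Qed.

Lemma Bsp_stable (R : realType) (n : nat) : exists2 c : R, 0 < c &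
  forall (N : nat) (a : nat -> R), (0 < N)%N ->
  c * mesh R N * \sum_(l < dimS n.+1 N) a l ^+ 2 <=
  \int[@lebesgue_measure R]_(x in `[-1, 1]) (spline n.+1 N a x) ^+ 2.
Proof.
have [C C0 hC] := @bspl_local_stable R n.
(* Each cell controls [n + 1] squared coefficients, each through the constant [C]. *)
pose c := (n.+1%:R * C)^-1.
have c0 : 0 < c by rewrite invr_gt0 mulr_gt0.
exists c => // N a N0.
have h0 := mesh_gt0 R N0; set h := mesh R N in h0 *.
have hN : h * N%:R = 2 by rewrite /h /mesh mulfVK// pnatr_eq0 -lt0n.
pose f x := (spline n.+1 N a x) ^+ 2.
have mf : measurable_fun setT f by apply: measurable_funX; exact: measurable_spline.
have fM : forall x, inI x -> `|f x| <= (\sum_(l < dimS n.+1 N) `|a l| * 2 ^+ n) ^+ 2.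
  move=> x _; rewrite /f normrX lerXn2r ?nnegrE ?sumr_ge0//.
  apply: le_trans (ler_norm_sum _ _ _) _; apply: ler_sum => l _.
  rewrite normrM ler_wpM2l//; apply: bspl_le; exact: knot_homo.
have cell k : (k < N)%N -> c * h * \sum_(i < n.+1) a (k + i)%N ^+ 2 <=
    \int[@lebesgue_measure R]_(x in `[-1 + h * k%:R, -1 + h * k.+1%:R]) f x.
  (* The knots seen from the cell: origin at its left end, unit [h]. They are integers advancing by
     at most 1 at a time, so near the cell they stay within [n] of the origin, whatever [N] is. *)
  move=> kN; pose t i : R := (minn N (i - n))%:R - k%:R.
  have tm : {homo t : i j / (i <= j)%N >-> i <= j}.
    move=> i j ij; rewrite /t lerD2r ler_nat.
    by rewrite leq_min !geq_min leqnn leq_sub2r// orbT.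
  have t0 : t (k + n)%N = 0 by rewrite /t addnK (minn_idPr _) ?subrr// ltnW.
  have t1 : t (k + n).+1 = 1.
    by rewrite /t -addSn addnK (minn_idPr _)// -[k.+1]addn1 natrD addrAC subrr add0r.
  have tb r : (k < r <= k + n + n)%N -> `|t r| <= n%:R.
    move=> /andP[r1 r2]; rewrite /t.
    have /andP[] : (k <= minn N (r - n) + n)%N && (minn N (r - n) <= k + n)%N.
      by lia.
    rewrite -!(ler_nat R) !natrD ler_norml => h1 h2; apply/andP; split; lra.
  have [p [pE pC]] := hC t k tm t0 t1 tb (fun i => a (k + i)%N).
  have ab : -1 + h * k.+1%:R = -1 + h * k%:R + h.
    by rewrite -[k.+1]addn1 natrD mulrDr mulr1 addrA.
  have hk : 0 <= h * k%:R by rewrite mulr_ge0// ltW.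
  have hk1 : h * k.+1%:R <= 2 by rewrite -hN ler_pM2l// ler_nat.
  have b1 : -1 + h * k.+1%:R <= 1 by lra.
  pose g x := (p ^+ 2).[(x - (-1 + h * k%:R)) / h].
  have fg x : -1 + h * k%:R <= x < -1 + h * k.+1%:R -> f x = g x.
    move=> xk; rewrite /f (spline_cell _ _ kN)// /g horner_exp; congr (_ ^+ 2).
    rewrite -pE; last first.
      case/andP: xk => xk1 xk2; rewrite divr_ge0 ?subr_ge0 ?(ltW h0)//=.
      by rewrite ltr_pdivrMr// mul1r ltrBlDl -ab.
    apply: eq_bigr => i _; congr (_ * _); rewrite /Bsp.
    rewrite -(@bspl_affine _ (knot R n.+1 N) t (-1 + h * k%:R) h)//.
      by congr bspl; field; rewrite gt_eqF.
    by move=> j; rewrite /knot /t /= -/h; ring.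
  have mg : measurable_fun setT g.
    have mp : measurable_fun setT (horner (p ^+ 2) : R -> R).
      by apply: continuous_measurable_fun; exact: continuous_horner.
    apply: (measurableT_comp mp); apply: measurable_funM => //.
    exact: measurable_funB.
  have intf (b : bool) : (@lebesgue_measure R).-integrable
      [set` Interval (BLeft (-1 + h * k%:R)) (BSide b (-1 + h * k.+1%:R))]
      (EFin \o f).
    apply: (integrable_bounded _ _ mf fM) => //; apply: subset_itv.
      by rewrite bnd_simp lerDl.
    by case: b; rewrite bnd_simp// ltW.
  (* The polynomial form holds on the half-open cell only; the right end point is dropped for the
     substitution and restored after it. *)
  rewrite -Rintegral_itv_bndo_bndc; last exact: intf.
  have -> : \int[@lebesgue_measure R]_(x in `[-1 + h * k%:R, -1 + h * k.+1%:R[) f x =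
      \int[@lebesgue_measure R]_(x in `[-1 + h * k%:R, -1 + h * k.+1%:R[) g x.
    by apply: eq_Rintegral => x; rewrite inE /= in_itv /= => /fg.
  rewrite Rintegral_itv_bndo_bndc; last first.
    apply: eq_integrable (intf true) => // x; rewrite inE /= in_itv /= => /fg.
    by move=> ->.
  rewrite ab Rintegral_cell_poly// mulrAC mulrC ler_pM2l//.
  rewrite /c mulrC ler_pdivrMr ?mulr_gt0// mulrA mulrC.
  apply: le_trans (_ : \sum_(i < n.+1) C * poly_int (p ^+ 2) <= _).
    by apply: ler_sum => i _; apply: pC; rewrite -ltnS.
  rewrite sumr_const card_ord -[leLHS]mulr_natr le_eqVlt; apply/orP; left.
  by apply/eqP; ring.
have ind K : (K <= N)%N -> c * h * \sum_(k < K) \sum_(i < n.+1) a (k + i)%N ^+ 2 <=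
    \int[@lebesgue_measure R]_(x in `[-1, -1 + h * K%:R]) f x.
  elim: K => [|K IH] KN.
    by rewrite big_ord0 mulr0; apply: Rintegral_ge0 => x _; exact: sqr_ge0.
  have hk : 0 <= h * K%:R by rewrite mulr_ge0// ltW.
  have hk1 : h * K.+1%:R <= h * N%:R by rewrite ler_pM2l// ler_nat.
  have hk2 : h * K%:R <= h * K.+1%:R by rewrite ler_pM2l// ler_nat.
  rewrite hN in hk1.
  rewrite big_ord_recr /= mulrDr (@Rintegral_split _ _ _ (-1 + h * K%:R) _ _ _ _ _ _ mf fM);
    [|lra..].
  by rewrite lerD ?cell// IH// ltnW.
have := ind N (leqnn N); rewrite hN (_ : -1 + 2 = 1); last by lra.
apply: le_trans; rewrite (ler_pM2l (mulr_gt0 c0 h0)).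
rewrite /dimS addnS /=; apply: (@sum_cells_ge _ n N (fun l => a l ^+ 2)) => // l.
exact: sqr_ge0.
Qed.

(** * The Riemann-Lebesgue lemma *)

Lemma continuous_unif_itv (R : realType) (g : R -> R) (e : R) :
  {within `[-1, 1], continuous g} -> 0 < e ->
  exists2 d : R, 0 < d & forall x y, inI x -> inI y -> `|x - y| < d ->
    `|g x - g y| < e.
Proof.
move=> /subspace_continuousP cg e0.
have cpt : compact `[-1, 1 : R] by exact: segment_compact.
move/compact_near_coveringP : cpt.
move=> /(_ R 0^'+ (fun d x => forall y, inI x -> inI y -> `|x - y| < d ->
    `|g x - g y| < e)).
have H : forall x, [set` `[(-1) : R, 1]] x -> \forall x' \near x & d \near 0^'+,
    forall y, inI x' -> inI y -> `|x' - y| < d -> `|g x' - g y| < e.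
  move=> x xI; have xI' : inI x by move: xI => /=; rewrite in_itv.
  have /cvgrPdist_lt/(_ (e / 2)) := cg x xI.
  rewrite divr_gt0// => /(_ isT).
  rewrite near_withinE /= => /nbhs_ballP[/= r r0 rP].
  have r2 : 0 < r / 2 by rewrite divr_gt0.
  have P z : inI z -> `|x - z| < r -> `|g x - g z| < e / 2.
    move=> zI xz; apply: rP => //; rewrite /ball //=.
  exists ([set z | `|x - z| < r / 2], [set d | d < r / 2]) => /=.
    split; first by apply/nbhs_ballP; exists (r / 2).
    exact: nbhs_right_lt.
  move=> [z d] /= [xz dr] y zI yI zy.
  have h1 : `|g x - g z| < e / 2 by apply: P => //; lra.
  have h2 : `|g x - g y| < e / 2.
    apply: P => //; rewrite (_ : x - y = (x - z) + (z - y)); last by ring.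
    apply: le_lt_trans (ler_normD _ _) _; lra.
  rewrite (_ : g z - g y = (g x - g y) - (g x - g z)); last by ring.
  apply: le_lt_trans (ler_normB _ _) _; lra.
move=> /(_ _ H) [d /= d0 dP].
exists (d / 2); first by rewrite divr_gt0.
move=> x y xI yI; apply: (dP (d / 2)) => //=.
  rewrite sub0r normrN gtr0_norm ?divr_gt0//; lra.
by rewrite divr_gt0.
Qed.

Lemma measurable_cos_affine (R : realType) (w phi : R) :
  measurable_fun setT (fun x : R => cos (w * x + phi)).
Proof.
apply: (@measurableT_comp _ _ _ _ _ _ cos _ (fun x => w * x + phi)).
  by apply: continuous_measurable_fun; exact: continuous_cos.
by apply: measurable_funD => //; exact: measurable_funM.
Qed.

Lemma Rintegral_cos_le (R : realType) (a b w phi : R) : a < b -> w != 0 ->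
  `|\int[@lebesgue_measure R]_(x in `[a, b]) cos (w * x + phi)| <= 2 / `|w|.
Proof.
move=> ab w0.
pose F (x : R) := sin (w * x + phi) / w.
have dF (x : R) : is_derive x 1 F (cos (w * x + phi)).
  have h : is_derive x 1 (fun x : R => w * x + phi) w.
    by apply: is_derive_eq; rewrite addr0 scaler1.
  have h2 := @is_derive1_comp _ sin (fun x : R => w * x + phi) x _ _
    (is_derive_sin (w * x + phi)) h.
  have h3 : is_derive x 1 (fun x : R => w^-1 *: sin (w * x + phi))
    (w^-1 *: (w * cos (w * x + phi))).
    apply: is_deriveZ; apply: is_derive_eq h2 _; by rewrite mulrC.
  rewrite /F; have -> : (fun x : R => sin (w * x + phi) / w) =
    (fun x : R => w^-1 *: sin (w * x + phi)) by apply/funext => y; rewrite mulrC.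
  by apply: is_derive_eq h3 _; rewrite /GRing.scale /= mulKf.
have cF : continuous F.
  move=> x; apply: differentiable_continuous; apply/derivable1_diffP.
  by have [] := dF x.
rewrite /Rintegral (@continuous_FTC2 _ _ F)//=.
- rewrite /F -mulrBl normrM normfV ler_wpM2r ?invr_ge0//.
  apply: le_trans (ler_normB _ _) _.
  have s1 (y : R) : `|sin y| <= 1 by rewrite ler_norml sin_geN1 sin_le1.
  by have := s1 (w * b + phi); have := s1 (w * a + phi); lra.
- apply: continuous_subspaceT => x; apply: continuous_comp.
    by apply: cvgD; [apply: cvgM; [exact: cvg_cst|exact: cvg_id]|exact: cvg_cst].
  exact: continuous_cos.
- split; first by move=> x _; have [] := dF x.
  + by apply: cvg_at_right_filter; exact: cF.
  + by apply: cvg_at_left_filter; exact: cF.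
- by move=> x _; rewrite derive1E; apply: derive_val.
Qed.

Definition intI (R : realType) (f : R -> R) : R :=
  \int[@lebesgue_measure R]_(x in `[-1, 1]) f x.

Lemma eq_intI (R : realType) (f g : R -> R) :
  (forall x, inI x -> f x = g x) -> intI f = intI g.
Proof. by move=> fg; apply: eq_Rintegral => x; rewrite inE /= in_itv => /fg. Qed.

Lemma intI_cst (R : realType) (c : R) : intI (fun=> c) = c * 2.
Proof.
rewrite /intI Rintegral_cst//= lebesgue_measure_itv /= lte_fin.
have -> : (-1 : R) < 1 by lra.
rewrite /=; by rewrite opprK.
Qed.

Definition bmeas (R : realType) (f : R -> R) : Prop :=
  measurable_fun setT f /\ exists M : R, forall x, inI x -> `|f x| <= M.

Lemma bmeas_integrable (R : realType) (f : R -> R) : bmeas f ->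
  (@lebesgue_measure R).-integrable `[-1, 1]%classic (EFin \o f).
Proof. by move=> [mf [M fM]]; exact: (integrable_bounded _ _ mf fM). Qed.

Lemma bmeas_cst (R : realType) (c : R) : bmeas (fun=> c).
Proof. by split=> //; exists `|c|. Qed.

Lemma bmeasD (R : realType) (f g : R -> R) :
  bmeas f -> bmeas g -> bmeas (fun x => f x + g x).
Proof.
move=> [mf [M fM]] [mg [N gN]]; split; first exact: measurable_funD.
exists (M + N) => x xI; apply: le_trans (ler_normD _ _) _.
by rewrite lerD ?fM ?gN.
Qed.

Lemma bmeasM (R : realType) (f g : R -> R) :
  bmeas f -> bmeas g -> bmeas (fun x => f x * g x).
Proof.
move=> [mf [M fM]] [mg [N gN]]; split; first exact: measurable_funM.
by exists (M * N) => x xI; rewrite normrM ler_pM ?fM ?gN.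
Qed.

Lemma bmeasN (R : realType) (f : R -> R) : bmeas f -> bmeas (fun x => - f x).
Proof.
move=> [mf [M fM]]; split; first exact: measurableT_comp.
by exists M => x xI; rewrite normrN fM.
Qed.

Lemma bmeasB (R : realType) (f g : R -> R) :
  bmeas f -> bmeas g -> bmeas (fun x => f x - g x).
Proof. by move=> bf bg; apply: bmeasD => //; exact: bmeasN. Qed.

Lemma bmeas_norm (R : realType) (f : R -> R) : bmeas f -> bmeas (fun x => `|f x|).
Proof.
move=> [mf [M fM]]; split; first exact: measurableT_comp.
by exists M => x xI; rewrite normr_id fM.
Qed.

Lemma bmeas_cos (R : realType) (w phi : R) : bmeas (fun x : R => cos (w * x + phi)).
Proof.
split; first exact: measurable_cos_affine.
by exists 1 => x _; rewrite ler_norml cos_geN1 cos_le1.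
Qed.

Lemma intID (R : realType) (f g : R -> R) : bmeas f -> bmeas g ->
  intI (fun x => f x + g x) = intI f + intI g.
Proof. by move=> bf bg; apply: RintegralD => //; exact: bmeas_integrable. Qed.

Lemma intIB (R : realType) (f g : R -> R) : bmeas f -> bmeas g ->
  intI (fun x => f x - g x) = intI f - intI g.
Proof. by move=> bf bg; apply: RintegralB => //; exact: bmeas_integrable. Qed.

Lemma intIZ (R : realType) (c : R) (f : R -> R) : bmeas f ->
  intI (fun x => c * f x) = c * intI f.
Proof. by move=> bf; apply: RintegralZl => //; exact: bmeas_integrable. Qed.

Lemma le_intI (R : realType) (f g : R -> R) : bmeas f -> bmeas g ->
  (forall x, inI x -> f x <= g x) -> intI f <= intI g.
Proof.
move=> bf bg fg; apply: le_Rintegral; [by []|exact: bmeas_integrable bf|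
  exact: bmeas_integrable bg|].
by move=> x /=; rewrite in_itv => /fg.
Qed.

Lemma norm_intI_le (R : realType) (f g : R -> R) : bmeas f -> bmeas g ->
  (forall x, inI x -> `|f x| <= g x) -> `|intI f| <= intI g.
Proof.
move=> bf bg fg; apply: le_trans (le_normr_Rintegral _ _) _ => //.
  exact: bmeas_integrable.
by apply: le_intI => //; exact: bmeas_norm.
Qed.

(** On short cells [g] is replaced by its value at the left end, and the cosine is integrated
    exactly. Uniformity in the phase [phi] covers the sine as well. *)
Lemma RL_continuous (R : realType) (g : R -> R) (e : R) :
  bmeas g -> {within `[-1, 1], continuous g} -> 0 < e ->
  exists W : R, forall w phi, W <= `|w| ->
    `|intI (fun x => g x * cos (w * x + phi))| <= e.
Proof.
move=> bg cg e0; have [mg [M0 gM0]] := bg.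
pose M := `|M0| + 1.
have M1 : 0 < M by rewrite ltr_wpDl.
have gM x : inI x -> `|g x| <= M.
  by move=> /gM0 h; apply: le_trans h _; rewrite /M; have := ler_norm M0; lra.
have e4 : 0 < e / 4 by rewrite divr_gt0.
have [d d0 dP] := continuous_unif_itv cg e4.
pose n := (Num.truncn (2 / d)).+1; pose h : R := 2 / n%:R.
have n0 : 0 < n%:R :> R by rewrite ltr0n.
have hd : h < d.
  rewrite /h ltr_pdivrMr// mulrC -ltr_pdivrMr//.
  by have /truncn_itv/andP[] : 0 <= 2 / d by rewrite divr_ge0// ltW.
have h0 : 0 < h by rewrite divr_gt0.
have hn : h * n%:R = 2 by rewrite /h mulfVK// gt_eqF.
(* The [n] cells contribute at most [2 n M / |w|] through the integrated cosine, to be brought below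
   [e / 2]; the oscillation of [g] takes the other half, [e / 4] times the length 2. The added 1
   keeps [w] away from 0. *)
exists (4 * n%:R * M / e + 1) => w phi Ww.
have w0 : 0 < `|w|.
  apply: lt_le_trans Ww; rewrite ltr_wpDl// divr_ge0 ?(ltW e0)//.
  by rewrite !mulr_ge0// ltW.
have wn0 : w != 0 by rewrite -normr_gt0.
pose f x := g x * cos (w * x + phi).
have bf : bmeas f by apply: bmeasM => //; exact: bmeas_cos.
have [mf [Mf fMf]] := bf.
have fM x : inI x -> `|f x| <= M.
  move=> xI; rewrite /f normrM -[leRHS]mulr1 ler_pM ?gM//.
  by rewrite ler_norml cos_geN1 cos_le1.
have cell a : -1 <= a -> a + h <= 1 ->
    `|\int[@lebesgue_measure R]_(x in `[a, a + h]) f x| <=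
    e / 4 * h + M * (2 / `|w|).
  move=> a1 ah.
  have sub : `[a, a + h]%classic `<=` `[-1, 1]%classic.
    by apply: subset_itv; rewrite bnd_simp.
  have mI : measurable (`[a, a + h]%classic : set R) by [].
  have aI : inI a by rewrite /inI a1 /=; lra.
  have int u : bmeas u -> (@lebesgue_measure R).-integrable
      `[a, a + h]%classic (EFin \o u).
    by move=> [mu [Mu uM]]; exact: integrable_bounded mu uM.
  pose f1 x := (g x - g a) * cos (w * x + phi).
  pose f2 x := g a * cos (w * x + phi).
  have bf1 : bmeas f1.
    apply: bmeasM; last exact: bmeas_cos.
    by apply: bmeasB => //; exact: bmeas_cst.
  have bf2 : bmeas f2 by apply: bmeasM; [exact: bmeas_cst|exact: bmeas_cos].
  have -> : \int[@lebesgue_measure R]_(x in `[a, a + h]) f x =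
      \int[@lebesgue_measure R]_(x in `[a, a + h]) (f1 x + f2 x).
    by apply: eq_Rintegral => x _; rewrite /f /f1 /f2; ring.
  rewrite RintegralD//; [|exact: int..].
  apply: le_trans (ler_normD _ _) _; apply: lerD.
    apply: le_trans (le_normr_Rintegral _ _) _ => //; first exact: int.
    apply: le_trans (_ : \int[@lebesgue_measure R]_(x in `[a, a + h]) (e / 4) <= _).
      apply: le_Rintegral => //; [|exact: int (bmeas_cst _)|].
        exact: int (bmeas_norm bf1).
      move=> x /=; rewrite in_itv /= => /andP[ax xa].
      have xI : inI x by rewrite /inI; apply/andP; split; lra.
      rewrite /f1 normrM -[leRHS]mulr1 ler_pM//.
        apply/ltW/dP => //; apply: le_lt_trans hd.
        by rewrite ger0_norm ?subr_ge0//; lra.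
      by rewrite ler_norml cos_geN1 cos_le1.
    rewrite Rintegral_cst//= lebesgue_measure_itv /= lte_fin ltrDl h0 /=.
    by rewrite addrAC subrr add0r.
  rewrite RintegralZl//; last exact: int (bmeas_cos _ _).
  rewrite normrM ler_pM// ?gM//; apply: Rintegral_cos_le => //.
  by rewrite ltrDl.
have ind j : (j <= n)%N ->
    `|\int[@lebesgue_measure R]_(x in `[-1, -1 + h * j%:R]) f x| <=
    j%:R * (e / 4 * h + M * (2 / `|w|)).
  elim: j => [|j IH] jn.
    by rewrite mulr0 addr0 mul0r set_itv1 Rintegral_set1 normr0.
  have hk : 0 <= h * j%:R by rewrite mulr_ge0// ltW.
  have hk1 : h * j.+1%:R <= h * n%:R by rewrite ler_pM2l// ler_nat.
  have ab : h * j.+1%:R = h * j%:R + h by rewrite -[j.+1]addn1 natrD mulrDr mulr1.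
  rewrite hn ab in hk1.
  rewrite ab (@Rintegral_split _ _ _ (-1 + h * j%:R) _ _ _ _ _ _ mf fM); [|lra..].
  apply: le_trans (ler_normD _ _) _.
  rewrite -[j.+1]addn1 natrD mulrDl mul1r lerD ?IH 1?ltnW//.
  by rewrite addrA; apply: cell; lra.
have := ind n (leqnn n); rewrite hn (_ : -1 + 2 = 1); last by lra.
move/le_trans; apply.
have -> : n%:R * (e / 4 * h + M * (2 / `|w|)) =
    e / 4 * (h * n%:R) + (2 * n%:R * M) / `|w| by ring.
rewrite hn.
suff : 2 * n%:R * M / `|w| <= e / 2 by lra.
rewrite ler_pdivrMr//.
have : 4 * n%:R * M / e <= `|w| by lra.
rewrite ler_pdivrMr// => hw; lra.
Qed.

(* By density of the continuous functions in L^1. *)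
Lemma RL_bmeas (R : realType) (g : R -> R) (e : R) : bmeas g -> 0 < e ->
  exists W : R, forall w phi, W <= `|w| ->
    `|intI (fun x => g x * cos (w * x + phi))| <= e.
Proof.
move=> bg e0; have e2 : 0 < e / 2 by rewrite divr_gt0.
have Ifin : (@lebesgue_measure R `[(-1)%R, 1%R]%classic < +oo)%E.
  by rewrite /= lebesgue_measure_itv /= lte_fin; case: ifP; rewrite // ltry.
have mI : measurable (`[-1, 1]%classic : set R) by [].
have [g_ [cg_ _ gcv]] := approximation_continuous_integrable mI Ifin
  (bmeas_integrable bg).
have /fine_cvgP[_ /cvgrPdist_le/(_ _ e2)] := gcv.
move=> [k _ /(_ k (leqnn _))] /=; rewrite sub0r normrN => kP.
have cg : continuous (g_ k) by exact: cg_.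
have bgk : bmeas (g_ k).
  split; first exact: continuous_measurable_fun.
  have : bounded_set (g_ k @` `[(-1 : R), 1]).
    apply: compact_bounded; apply: continuous_compact; last exact: segment_compact.
    exact: continuous_subspaceT.
  move=> [M [_ MP]]; exists (M + 1) => x xI.
  by apply: (MP (M + 1)); [rewrite ltrDl|exists x => //=; rewrite in_itv].
have [W WP] := RL_continuous bgk (continuous_subspaceT cg) e2.
exists W => w phi Ww; pose c x : R := cos (w * x + phi).
have bc : bmeas c by exact: bmeas_cos.
rewrite (@eq_intI _ _ (fun x => (g x - g_ k x) * c x + g_ k x * c x)); last first.
  by move=> x _; rewrite /c; ring.
have bd : bmeas (fun x => g x - g_ k x) by exact: bmeasB.
rewrite intID; [|by apply: bmeasM..].
apply: le_trans (ler_normD _ _) _; have h := WP w phi Ww.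
suff h2 : `|intI (fun x => (g x - g_ k x) * c x)| <= e / 2.
  by apply: le_trans (lerD h2 h) _; lra.
apply: le_trans kP; apply: le_trans (ler_norm _); rewrite -/(Rintegral _ _ _).
apply: norm_intI_le; [exact: bmeasM|exact: bmeas_norm|].
move=> x _; rewrite normrM -[leRHS]mulr1 ler_wpM2l//.
by rewrite ler_norml cos_geN1 cos_le1.
Qed.

(** * Complex-valued integrals and oscillatory double integrals *)

Local Notation normc := Normc.normc.

Lemma normc_Re_Im (R : realType) (z : R[i]) :
  normc z <= `|complex.Re z| + `|complex.Im z|.
Proof.
case: z => x y /=; rewrite -[leRHS]ger0_norm ?addr_ge0// -sqrtr_sqr ler_wsqrtr//.
rewrite sqrrD !real_normK ?num_real// addrAC lerDl.
by rewrite mulrn_wge0// mulr_ge0.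
Qed.

Lemma Re_le_normc (R : realType) (z : R[i]) : `|complex.Re z| <= normc z.
Proof.
by case: z => x y /=; rewrite -sqrtr_sqr ler_wsqrtr// lerDl sqr_ge0.
Qed.

Lemma Im_le_normc (R : realType) (z : R[i]) : `|complex.Im z| <= normc z.
Proof.
by case: z => x y /=; rewrite -sqrtr_sqr ler_wsqrtr// lerDr sqr_ge0.
Qed.

Lemma normc_ge0 (R : realType) (z : R[i]) : 0 <= normc z.
Proof. by case: z => x y; exact: sqrtr_ge0. Qed.

Lemma normc_expi (R : realType) (x : R) : normc (expi x) = 1.
Proof. by rewrite /= cos2Dsin2 sqrtr1. Qed.

Lemma normc_real (R : realType) (x : R) : normc (x%:C)%C = `|x|.
Proof. by rewrite /= expr0n addr0 sqrtr_sqr. Qed.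

Lemma expiD (R : realType) (x y : R) : expi (x + y) = expi x * expi y.
Proof.
rewrite /expi cosD sinD; apply/eqP; rewrite eq_complex /= eqxx /=.
by apply/eqP; ring.
Qed.

Lemma expi0 (R : realType) : expi (0 : R) = 1.
Proof. by rewrite /expi cos0 sin0. Qed.

Definition cbmeas (R : realType) (g : R -> R[i]) : Prop :=
  bmeas (fun x => complex.Re (g x)) /\ bmeas (fun x => complex.Im (g x)).

Lemma cintE (R : realType) (g : R -> R[i]) : cint g =
  (intI (fun x => complex.Re (g x)) +i* intI (fun x => complex.Im (g x)))%C.
Proof. by []. Qed.

Lemma eq_cint (R : realType) (f g : R -> R[i]) :
  (forall x, inI x -> f x = g x) -> cint f = cint g.
Proof. by move=> fg; rewrite !cintE; congr Complex; apply: eq_intI => x /fg ->. Qed.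

Lemma eq_bmeas (R : realType) (f g : R -> R) : f =1 g -> bmeas f -> bmeas g.
Proof. by move=> /funext ->. Qed.

Lemma cbmeasM (R : realType) (f g : R -> R[i]) :
  cbmeas f -> cbmeas g -> cbmeas (fun x => f x * g x).
Proof.
move=> [f1 f2] [g1 g2]; split.
  apply: eq_bmeas (bmeasB (bmeasM f1 g1) (bmeasM f2 g2)) => x.
  by case: (f x) (g x) => [a b] [c d].
apply: eq_bmeas (bmeasD (bmeasM f1 g2) (bmeasM f2 g1)) => x.
by case: (f x) (g x) => [a b] [c d].
Qed.

Lemma cbmeas_real (R : realType) (b : R -> R) :
  bmeas b -> cbmeas (fun x => (b x)%:C%C).
Proof. by move=> bb; split => //=; exact: bmeas_cst. Qed.

Lemma sinEcos (R : realType) (x : R) : sin x = cos (x + - (pi / 2)).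
Proof. by rewrite cosBpihalf. Qed.

Lemma cbmeas_expi (R : realType) (w : R) : cbmeas (fun x => expi (w * x)).
Proof.
split=> /=.
  by apply: eq_bmeas (bmeas_cos w 0) => x; rewrite addr0.
by apply: eq_bmeas (bmeas_cos w (- (pi / 2))) => x; rewrite sinEcos.
Qed.

Lemma cbmeas_normc (R : realType) (g : R -> R[i]) :
  cbmeas g -> bmeas (fun x => normc (g x)).
Proof.
move=> [g1 g2]; split.
  have -> : (fun x => normc (g x)) = (fun x => Num.sqrt
      (complex.Re (g x) ^+ 2 + complex.Im (g x) ^+ 2)).
    by apply/funext => x; case: (g x).
  apply: (@measurableT_comp _ _ _ _ _ _ (@Num.sqrt R)).
    by apply: continuous_measurable_fun; exact: sqrt_continuous.
  by apply: measurable_funD; apply: measurable_funX; [exact: g1.1|exact: g2.1].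
have [[_ [M1 h1]] [_ [M2 h2]]] := (g1, g2).
exists (M1 + M2) => x xI; rewrite ger0_norm ?normc_ge0//.
by apply: le_trans (normc_Re_Im _) _; rewrite lerD ?h1 ?h2.
Qed.

Lemma cintD (R : realType) (f g : R -> R[i]) : cbmeas f -> cbmeas g ->
  cint (fun x => f x + g x) = cint f + cint g.
Proof.
move=> [f1 f2] [g1 g2]; rewrite !cintE /=; apply/eqP; rewrite eq_complex /=.
rewrite -!intID//; apply/andP; split; apply/eqP; apply: eq_intI => x _;
  by case: (f x) (g x) => [a b] [c d].
Qed.

(** The factor 2 comes from bounding the real and the imaginary parts separately. *)
Lemma normc_cint_le (R : realType) (g : R -> R[i]) (G : R -> R) :
  cbmeas g -> bmeas G -> (forall x, inI x -> normc (g x) <= G x) ->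
  normc (cint g) <= 2 * intI G.
Proof.
move=> [g1 g2] bG gG; apply: le_trans (normc_Re_Im _) _.
rewrite cintE /= mulr_natl mulr2n; apply: lerD.
  by apply: norm_intI_le => // x xI; apply: le_trans (Re_le_normc _) (gG _ xI).
by apply: norm_intI_le => // x xI; apply: le_trans (Im_le_normc _) (gG _ xI).
Qed.

Lemma RL_cint (R : realType) (g : R -> R[i]) (e : R) : cbmeas g -> 0 < e ->
  exists W : R, forall w, W <= `|w| ->
    normc (cint (fun x => g x * expi (w * x))) <= e.
Proof.
move=> [g1 g2] e0; have e4 : 0 < e / 4 by rewrite divr_gt0.
have [W1 h1] := RL_bmeas g1 e4; have [W2 h2] := RL_bmeas g2 e4.
exists (Num.max W1 W2) => w; rewrite ge_max => /andP[w1 w2].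
pose p : R := - (pi / 2).
have C (f : R -> R) phi : bmeas f -> bmeas (fun x => f x * cos (w * x + phi)).
  by move=> bf; apply: bmeasM => //; exact: bmeas_cos.
have E : cint (fun x => g x * expi (w * x)) =
  ((intI (fun x => complex.Re (g x) * cos (w * x + 0)) -
    intI (fun x => complex.Im (g x) * cos (w * x + p))) +i*
   (intI (fun x => complex.Re (g x) * cos (w * x + p)) +
    intI (fun x => complex.Im (g x) * cos (w * x + 0))))%C.
  rewrite cintE -intIB; [|exact: C..]; rewrite -intID; [|exact: C..].
  congr Complex; apply: eq_intI => x _;
  by rewrite /p -sinEcos addr0; case: (g x).
rewrite E; apply: le_trans (normc_Re_Im _) _ => /=.
have a1 := h1 w 0 w1; have a2 := h1 w p w1.
have b1 := h2 w 0 w2; have b2 := h2 w p w2.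
apply: le_trans (lerD (ler_normB _ _) (ler_normD _ _)) _; lra.
Qed.

(** Tonelli's theorem applies to nonnegative functions: [F] is shifted by its bound [B] and cut off
    outside I, and the integral [2 B] of the shift is subtracted afterwards. *)
Lemma measurable_intI2 (R : realType) (F : R * R -> R) (B : R) :
  measurable_fun setT F -> (forall p, `|F p| <= B) ->
  measurable_fun setT (fun s => intI (fun t => F (s, t))).
Proof.
move=> mF FB.
pose G (p : R * R) : \bar R := ((F p + B) * \1_(`[-1, 1]%classic : set R) p.2)%:E.
have mG : measurable_fun setT G.
  apply/measurable_EFinP; apply: measurable_funM; first exact: measurable_funD.
  by apply: measurableT_comp; [exact: measurable_indic|exact: measurable_snd].
have G0 p : (0 <= G p)%E.
  rewrite lee_fin mulr_ge0//.
  by have := FB p; rewrite ler_norml => /andP[]; rewrite lerNl; lra.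
have h := @measurable_fun_fubini_tonelli_F _ _ _ _ _ (@lebesgue_measure R) G mG G0.
have mFs s : bmeas (fun t => F (s, t)).
  split; first exact: measurable_fun_pair2 mF.
  by exists B => t _; exact: FB.
have -> : (fun s => intI (fun t => F (s, t))) =
    (fun s => fine (fubini_F (@lebesgue_measure R) G s) - B * 2).
  apply/funext => s; rewrite /fubini_F /G.
  rewrite -intI_cst -[LHS]addr0 -(subrr (intI (fun=> B))) addrA; congr (_ - _).
  rewrite -intID; [|exact: mFs|exact: bmeas_cst].
  rewrite /intI Rintegral_mkcond /Rintegral; congr fine; apply: eq_integral => x _.
  rewrite patchE /= indicE; case: (x \in _); by rewrite ?mulr1 ?mulr0.
apply: measurable_funB => //; apply: (measurableT_comp _ h).
exact: fine_measurable.
Qed.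

(** Joint measurability and the bound are required on the whole plane, so that sections and products
    carry no domain condition. *)
Definition bkernel (R : realType) (M : R) (k : R -> R -> R[i]) : Prop :=
  [/\ measurable_fun setT (fun p : R * R => complex.Re (k p.1 p.2)),
      measurable_fun setT (fun p : R * R => complex.Im (k p.1 p.2)) &
      forall s t, normc (k s t) <= M].

Lemma bkernelM (R : realType) (M N : R) (k l : R -> R -> R[i]) :
  bkernel M k -> bkernel N l -> bkernel (M * N) (fun s t => k s t * l s t).
Proof.
move=> [k1 k2 kM] [l1 l2 lN]; split; last first.
  by move=> s t; rewrite Normc.normcM ler_pM ?normc_ge0.
- have -> : (fun p : R * R => complex.Im (k p.1 p.2 * l p.1 p.2)) = (fun p =>
      complex.Re (k p.1 p.2) * complex.Im (l p.1 p.2) +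
      complex.Im (k p.1 p.2) * complex.Re (l p.1 p.2)).
    by apply/funext => p; case: (k _ _) (l _ _) => [a b] [c d].
  by apply: measurable_funD; apply: measurable_funM.
have -> : (fun p : R * R => complex.Re (k p.1 p.2 * l p.1 p.2)) = (fun p =>
    complex.Re (k p.1 p.2) * complex.Re (l p.1 p.2) -
    complex.Im (k p.1 p.2) * complex.Im (l p.1 p.2)).
  by apply/funext => p; case: (k _ _) (l _ _) => [a b] [c d].
by apply: measurable_funB; apply: measurable_funM.
Qed.

Lemma bkernel_real (R : realType) (M : R) (b : R * R -> R) :
  measurable_fun setT b -> (forall p, `|b p| <= M) ->
  bkernel M (fun s t => (b (s, t))%:C%C).
Proof.
move=> mb bM; split=> [||s t]; [|exact: measurable_cst|].
  by rewrite (_ : (fun p => _) = b)//; apply/funext => -[].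
by rewrite normc_real.
Qed.

Lemma bkernel_expi (R : realType) (w : R) : bkernel 1 (fun _ t : R => expi (w * t)).
Proof.
have [[m1 _] [m2 _]] := cbmeas_expi w.
split; last by move=> _ t; rewrite normc_expi.
- exact: (measurableT_comp m1 measurable_snd).
- exact: (measurableT_comp m2 measurable_snd).
Qed.

Lemma bkernel_section (R : realType) (M : R) (k : R -> R -> R[i]) (s : R) :
  bkernel M k -> cbmeas (k s).
Proof.
move=> [k1 k2 kM]; split; split.
- exact: (measurable_fun_pair2 _ k1).
- by exists M => t _; apply: le_trans (Re_le_normc _) (kM _ _).
- exact: (measurable_fun_pair2 _ k2).
- by exists M => t _; apply: le_trans (Im_le_normc _) (kM _ _).
Qed.

Lemma normc_cint_kernel (R : realType) (M : R) (k : R -> R -> R[i]) (s : R) :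
  bkernel M k -> normc (cint (k s)) <= 4 * M.
Proof.
move=> bk; have := normc_cint_le (bkernel_section s bk) (bmeas_cst M).
have [_ _ kM] := bk.
by rewrite intI_cst => /(_ (fun t _ => kM s t)) h; apply: le_trans h _; lra.
Qed.

Lemma cbmeas_cint2 (R : realType) (M : R) (k : R -> R -> R[i]) :
  bkernel M k -> cbmeas (fun s => cint (k s)).
Proof.
move=> bk; have [k1 k2 kM] := bk; split; split.
- rewrite /=; apply: (@measurable_intI2 _ (fun p => complex.Re (k p.1 p.2)) M) => //.
  by move=> p; apply: le_trans (Re_le_normc _) (kM _ _).
- exists (4 * M) => s _; apply: le_trans (Re_le_normc _) _.
  exact: normc_cint_kernel.
- rewrite /=; apply: (@measurable_intI2 _ (fun p => complex.Im (k p.1 p.2)) M) => //.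
  by move=> p; apply: le_trans (Im_le_normc _) (kM _ _).
- exists (4 * M) => s _; apply: le_trans (Im_le_normc _) _.
  exact: normc_cint_kernel.
Qed.

(** For each [s] the inner integral tends to 0 by the Riemann-Lebesgue lemma, and it is bounded by
    [4 M]; dominated convergence along sequences does the rest. *)
Lemma intI_cint_to0 (R : realType) (M : R) (k : R -> R -> R[i]) (a e : R) :
  bkernel M k -> a != 0 -> 0 < e -> exists k0 : R, forall w, k0 <= w ->
    intI (fun s => normc (cint (fun t => k s t * expi (w * a * t)))) <= e.
Proof.
move=> bk a0 e0.
have M0 : 0 <= M by have [_ _ kM] := bk; exact: le_trans (normc_ge0 _) (kM 0 0).
have bkw w : bkernel M (fun s t => k s t * expi (w * a * t)).
  by rewrite -[M]mulr1; apply: bkernelM => //; exact: bkernel_expi.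
pose Phi w s := normc (cint (fun t => k s t * expi (w * a * t))).
have bPhi w : bmeas (Phi w) by apply: cbmeas_normc; exact: cbmeas_cint2 (bkw w).
have PhiM w s : `|Phi w s| <= 4 * M.
  by rewrite ger0_norm ?normc_ge0//; exact: normc_cint_kernel (bkw w).
suff : intI (Phi x) @[x --> +oo%R] --> (0 : R).
  move=> /cvgrPdist_le/(_ _ e0) [k0 [_ hk]]; exists (k0 + 1) => w wk.
  have := hk w; rewrite /= sub0r normrN => h.
  apply: le_trans (ler_norm _) (h _); lra.
apply/cvg_pinftyP => u uoo.
have mI : measurable (`[-1, 1]%classic : set R) by [].
have := @dominated_convergence _ _ _ (@lebesgue_measure R) _ mI
  (fun n s => (Phi (u n) s)%:E) (fun=> 0%E) (fun=> (4 * M)%:E).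
case.
- move=> n; apply/measurable_EFinP; apply: measurable_funTS.
  by have [] := bPhi (u n).
- exact: measurable_cst.
- apply: aeW => s _; apply: cvg_EFin; first by apply: nearW.
  apply/cvgrPdist_le => d d0 /=.
  have [W WP] := RL_cint (bkernel_section s bk) d0.
  have /cvgryPge/(_ (`|W| / `|a|)) uW := uoo.
  near=> n; rewrite sub0r normrN ger0_norm ?normc_ge0//.
  apply: WP; rewrite normrM -ler_pdivrMr ?normr_gt0//.
  have : `|W| / `|a| <= u n by near: n.
  have := ler_norm (u n); have : W / `|a| <= `|W| / `|a|.
    by rewrite ler_wpM2r ?invr_ge0// ler_norm.
  by lra.
- exact: (bmeas_integrable (bmeas_cst (4 * M))).
- by apply: aeW => s n _ /=; rewrite lee_fin.
move=> _ _ /=; rewrite integral0 => /fine_cvgP[_].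
apply: cvg_trans; apply: near_eq_cvg; exact: nearW.
Unshelve. all: by end_near.
Qed.

(* If [a != 0] the inner integral tends to [0] boundedly; otherwise it does not
   depend on [w] and the outer one tends to [0]. *)
Lemma cint2_to0 (R : realType) (M : R) (k : R -> R -> R[i]) (b : R -> R)
    (a c e : R) : bkernel M k -> bmeas b -> (a != 0) || (c != 0) -> 0 < e ->
  exists k0 : R, forall w, k0 <= w ->
    normc (cint (fun s => (b s)%:C%C * expi (w * c * s) *
      cint (fun t => k s t * expi (w * a * t)))) <= e.
Proof.
move=> bk bb ac e0; have [_ [N0 bN0]] := bb.
pose N := `|N0| + 1.
have N1 : 0 < N by rewrite ltr_wpDl.
have bN x : inI x -> `|b x| <= N.
  by move=> /bN0 h; apply: le_trans h _; rewrite /N; have := ler_norm N0; lra.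
have M0 : 0 <= M by have [_ _ kM] := bk; exact: le_trans (normc_ge0 _) (kM 0 0).
have bkw w : bkernel M (fun s t => k s t * expi (w * a * t)).
  by rewrite -[M]mulr1; apply: bkernelM => //; exact: bkernel_expi.
have [a0|a0] := eqVneq a 0.
  rewrite a0 eqxx /= in ac; rewrite a0.
  have bF : cbmeas (fun s => (b s)%:C%C * cint (k s)).
    apply: cbmeasM; [exact: cbmeas_real|exact: cbmeas_cint2 bk].
  have [W WP] := RL_cint bF e0.
  exists (`|W| / `|c|) => w hw.
  rewrite (@eq_cint _ _ (fun s => (b s)%:C%C * cint (k s) * expi (w * c * s))).
    apply: WP; rewrite normrM -ler_pdivrMr ?normr_gt0//.
    have := ler_norm w; have : W / `|c| <= `|W| / `|c|.
      by rewrite ler_wpM2r ?invr_ge0// ler_norm.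
    by lra.
  move=> s _; rewrite mulrAC; congr (_ * _ * _); apply: eq_cint => t _.
  by rewrite mulr0 mul0r expi0 mulr1.
have eN : 0 < e / (2 * N) by rewrite divr_gt0// mulr_gt0.
have [k0 hk] := intI_cint_to0 bk a0 eN.
exists k0 => w /hk h.
pose Phi s := cint (fun t => k s t * expi (w * a * t)).
have cPhi : cbmeas Phi by exact: cbmeas_cint2 (bkw w).
apply: le_trans (normc_cint_le (G := fun s => N * normc (Phi s)) _ _ _) _.
- by apply: cbmeasM => //; apply: cbmeasM; [exact: cbmeas_real|exact: cbmeas_expi].
- by apply: bmeasM; [exact: bmeas_cst|exact: cbmeas_normc].
- move=> s sI; rewrite !Normc.normcM normc_expi mulr1 normc_real.
  by rewrite ler_wpM2r ?normc_ge0// bN.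
rewrite intIZ; last exact: cbmeas_normc.
by rewrite mulrA mulrC -ler_pdivlMr// mulr_gt0.
Qed.

(** * Bounded measurable extension of the kernel to the plane *)

Lemma open_measurable2 (R : realType) (W : set (R * R)) : open W -> measurable W.
Proof.
move=> oW.
pose box (q : rat * rat * (rat * rat)) : set (R * R) :=
  `]ratr q.1.1, ratr q.1.2[%classic `*` `]ratr q.2.1, ratr q.2.2[%classic.
(* An open set is the union of the rational boxes that it contains, a countable family. *)
have -> : W = \bigcup_(q in [set q | box q `<=` W]) box q.
  apply/seteqP; split=> [p pW|p [q /= qW pq]]; last exact: qW.
  have /nbhs_ballP[e /= e0 eW] : nbhs p W by exact: open_nbhs_nbhs.
  have [a /[!in_itv]/= /andP[a1 a2]] := @rat_in_itvoo R (p.1 - e) p.1 ltac:(lra).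
  have [b /[!in_itv]/= /andP[b1 b2]] := @rat_in_itvoo R p.1 (p.1 + e) ltac:(lra).
  have [c /[!in_itv]/= /andP[c1 c2]] := @rat_in_itvoo R (p.2 - e) p.2 ltac:(lra).
  have [d /[!in_itv]/= /andP[d1 d2]] := @rat_in_itvoo R p.2 (p.2 + e) ltac:(lra).
  exists ((a, b), (c, d)) => /=; last first.
    by rewrite /box /=; split => /=; rewrite in_itv /=; apply/andP.
  move=> [x y]; rewrite /box /= => -[/=]; rewrite !in_itv /=.
  move=> /andP[x1 x2] /andP[y1 y2]; apply: eW; split => /=;
    rewrite /ball /= ltr_norml; apply/andP; split; lra.
rewrite bigcup_mkcond; apply: countable_bigcupT_measurable => [|q].
  exact: countableP.
case: ifP => // _; by apply: measurableX; exact: measurable_itv.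
Qed.

Lemma continuous_measurable_fun2 (R : realType) (f : R * R -> R) :
  continuous f -> measurable_fun setT f.
Proof.
move=> cf; apply: (measurability _ (RGenOpens.measurableE R)) => //.
move=> _ [_ [a [b ->]] <-]; rewrite setTI; apply: open_measurable2.
by apply: open_comp => // x _; exact: cf.
Qed.

(** Composing with the retraction of the plane onto I^2, which clamps each coordinate, turns
    continuity on the square into continuity everywhere; compactness of the square gives the
    bound. *)
Lemma Cm_I2_real_extend (R : realType) (m : nat) (F : R -> R -> R) :
  Cm_I2_real m F -> exists (G : R * R -> R) (B : R),
    [/\ measurable_fun setT G, forall p, `|G p| <= B &
        forall s t, inI s -> inI t -> G (s, t) = F s t].
Proof.
move=> [D [DF _ _ /(_ 0%N 0%N (leq0n _) (leq0n _))]].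
rewrite /cont_on_I2; set A := [set p : R * R | _] => cD.
pose f (p : R * R) := D 0%N 0%N p.1 p.2.
pose cl (x : R) := Num.max (-1) (Num.min x 1).
have clI x : inI (cl x).
  rewrite /inI /cl le_max lexx /= ge_max ge_min lexx orbT andbT; lra.
have clE x : inI x -> cl x = x.
  by move=> /andP[x1 x2]; rewrite /cl (min_idPl x2) (max_idPr x1).
have ccl : continuous cl.
  move=> x.
  apply: (@continuous_max R R (fun=> -1) (fun y => Num.min y 1) x).
    exact: cvg_cst.
  by apply: (@continuous_min R R id (fun=> 1) x); [exact: cvg_id|exact: cvg_cst].
pose cl2 (p : R * R) := (cl p.1, cl p.2).
have cA p : A (cl2 p) by split => /=.
have cptA : compact A.
  have -> : A = `[-1, 1]%classic `*` `[-1, 1]%classic.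
    by apply/seteqP; split => -[x y] [] /=; rewrite /inI !in_itv.
  by apply: compact_setX; exact: segment_compact.
have [M [_ MP]] : bounded_set (f @` A).
  by apply: compact_bounded; exact: continuous_compact.
exists (f \o cl2), (M + 1); split.
- apply: continuous_measurable_fun2 => p.
  move/subspace_continuousP : cD => /(_ _ (cA p)) /cvgrPdist_lt cD.
  apply/cvgrPdist_lt => e /cD.
  rewrite near_withinE => h.
  have cp : {for p, continuous cl2}.
    have c1 : {for p, continuous (cl \o fst)}.
      by apply: continuous_comp; [exact: cvg_fst|exact: ccl].
    have c2 : {for p, continuous (cl \o snd)}.
      by apply: continuous_comp; [exact: cvg_snd|exact: ccl].
    exact: (cvg_pair c1 c2).
  have h2 : nbhs p (cl2 @^-1` (fun q => A q -> `|f (cl2 p) - f q| < e)) by exact: cp h.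
  by apply: filterS h2 => q /= hq; exact: hq (cA q).
- have MM : M < M + 1 by rewrite ltrDl.
  by move=> p; apply: (MP _ MM (f (cl2 p))); exists (cl2 p).
- by move=> s t sI tI; rewrite /f /cl2 /= !clE// DF.
Qed.

Lemma Cm_I2_kernel (R : realType) (m : nat) (K : R -> R -> R[i]) :
  Cm_I2 m K -> exists (M : R) (k : R -> R -> R[i]),
    bkernel M k /\ forall s t, inI s -> inI t -> k s t = K s t.
Proof.
move=> [/Cm_I2_real_extend[G [B [mG GB GE]]] /Cm_I2_real_extend[H [C [mH HC HE]]]].
exists (B + C), (fun s t => (G (s, t) +i* H (s, t))%C); split; last first.
  by move=> s t sI tI; rewrite GE// HE//; case: (K s t).
split=> [||s t].
- by rewrite (_ : (fun p => _) = G)//; apply/funext => -[].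
- by rewrite (_ : (fun p => _) = H)//; apply/funext => -[].
- by apply: le_trans (normc_Re_Im _) _; rewrite /= lerD.
Qed.

(** * Limits of the matrix entries *)

Lemma ler_normcD (R : realType) (x y : R[i]) : normc (x + y) <= normc x + normc y.
Proof. exact: (@le_normcD R x y). Qed.

Lemma normc_opp (R : realType) (x : R[i]) : normc (- x) = normc x.
Proof. exact: (@normcN R x). Qed.

Lemma cintZ (R : realType) (z : R[i]) (f : R -> R[i]) : cbmeas f ->
  cint (fun x => z * f x) = z * cint f.
Proof.
move=> [f1 f2]; case: z => a b; rewrite !cintE /=.
have Z c (u : R -> R) : bmeas u -> bmeas (fun x => c * u x).
  by move=> bu; apply: bmeasM => //; exact: bmeas_cst.
apply/eqP; rewrite eq_complex /=; apply/andP; split; apply/eqP.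
  rewrite -!intIZ// -intIB; [|exact: Z..].
  by apply: eq_intI => x _; case: (f x).
rewrite -!intIZ// -intID; [|exact: Z..].
by apply: eq_intI => x _; case: (f x).
Qed.

Lemma cint_real (R : realType) (f : R -> R) :
  cint (fun x => (f x)%:C%C) = (intI f)%:C%C.
Proof. by rewrite cintE /= intI_cst mul0r. Qed.

Lemma conj_expi (R : realType) (x : R) : conjc (expi x) = expi (- x).
Proof. by rewrite /expi cosN sinN. Qed.

Lemma conjcM (R : realType) (x y : R[i]) : conjc (x * y) = conjc x * conjc y.
Proof. exact: rmorphM. Qed.

Lemma conj_real (R : realType) (x : R) : conjc (x%:C)%C = (x%:C)%C.
Proof. by rewrite /= oppr0. Qed.

Lemma cint2_lim (R : realType) (M : R) (k : R -> R -> R[i]) (b : R -> R)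
    (a c e : R) : bkernel M k -> bmeas b -> 0 < e ->
  exists k0 : R, forall w, k0 <= w ->
    normc (cint (fun s => (b s)%:C%C * expi (w * c * s) *
      cint (fun t => k s t * expi (w * a * t))) -
      (if (a == 0) && (c == 0) then cint (fun s => (b s)%:C%C * cint (k s))
       else 0)) <= e.
Proof.
move=> bk bb e0; case: ifPn => [/andP[/eqP -> /eqP ->]|]; last first.
  rewrite negb_and => ac; have [k0 hk] := cint2_to0 bk bb ac e0.
  by exists k0 => w /hk; rewrite subr0.
exists 0 => w _; rewrite [X in X - _](_ : _ = cint (fun s => (b s)%:C%C * cint (k s))).
  by rewrite subrr Normc.normc0 ltW.
apply: eq_cint => s _; rewrite mulr0 mul0r expi0 mulr1; congr (_ * _).
by apply: eq_cint => t _; rewrite mul0r expi0 mulr1.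
Qed.

Definition gram (R : realType) (m N l j : nat) : R :=
  intI (fun x : R => Bsp m N l x * Bsp m N j x).

Definition tri (R : realType) (b : bool) (s t : R) : R :=
  if (t <= s) == b then 1 else 0.

Definition trik (R : realType) (k : R -> R -> R[i]) (m N : nat) (b : bool)
    (l : nat) (s t : R) : R[i] :=
  (tri b s t * Bsp m N l t)%:C%C * k s t.

(* Galerkin matrix of one of the two Volterra operators left over from the
   oscillatory operator in the limit [kappa -> +oo]. *)
Definition volt (R : realType) (k : R -> R -> R[i]) (m N : nat) (b : bool)
    (l j : nat) : R[i] :=
  cint (fun s => (Bsp m N j s)%:C%C * cint (trik k m N b l s)).

Lemma Bsp_le (R : realType) (m N l : nat) (x : R) : `|Bsp m N l x| <= 2 ^+ m.-1.
Proof. by apply: bspl_le; exact: knot_homo. Qed.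

Lemma bmeas_Bsp (R : realType) (m N l : nat) : bmeas (@Bsp R m N l).
Proof.
by split; [exact: measurable_Bsp|exists (2 ^+ m.-1) => x _; exact: Bsp_le].
Qed.

Lemma tri_le (R : realType) b (s t : R) : `|tri b s t| <= 1.
Proof. by rewrite /tri; case: ifP; rewrite ?normr1 ?normr0. Qed.

Lemma bkernel_trik (R : realType) (k : R -> R -> R[i]) (M : R) (m N : nat)
    (b : bool) (l : nat) : bkernel M k ->
  bkernel (2 ^+ m.-1 * M) (trik k m N b l).
Proof.
move=> bk; apply: bkernelM => //.
apply: (@bkernel_real _ _ (fun p => tri b p.1 p.2 * Bsp m N l p.2)) => [|p].
  apply: measurable_funM.
    have mle : measurable_fun setT (fun p : R * R => p.2 <= p.1).
      by apply: measurable_fun_ler; [exact: measurable_snd|exact: measurable_fst].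
    rewrite /tri; case: b.
      rewrite (_ : (fun p : R * R => _) = (fun p => if p.2 <= p.1 then 1 else 0)).
        exact: measurable_fun_ifT.
      by apply/funext => p; case: (p.2 <= p.1).
    rewrite (_ : (fun p : R * R => _) = (fun p => if p.2 <= p.1 then 0 else 1)).
      exact: measurable_fun_ifT.
    by apply/funext => p; case: (p.2 <= p.1).
  exact: (measurableT_comp (@measurable_Bsp R m N l) measurable_snd).
by rewrite normrM -[leRHS]mul1r ler_pM ?tri_le ?Bsp_le.
Qed.

(** For [t <= s] the kernel carries the phase exp(i kappa s) exp(-i kappa t), which cancels exactly
    when trial and test functions both oscillate like exp(i kappa x), that is [p = q = 2]; for
    [t > s] the signs are reversed and [p = q = 0]. *)
Definition lim_entry (R : realType) (k : R -> R -> R[i]) (m N p l q j : nat) :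
    R[i] :=
  (if p == q then (gram R m N l j)%:C%C else 0) -
  ((if (p == 2%N) && (q == 2%N) then volt k m N true l j else 0) +
   (if (p == 0%N) && (q == 0%N) then volt k m N false l j else 0)).

Lemma ip_phi (R : realType) (m N : nat) (kappa : R) (p l q j : nat) :
  ip (phi m N kappa p l) (phi m N kappa q j) =
  cint (fun x => (Bsp m N l x * Bsp m N j x)%:C%C *
    expi (kappa * (p%:R - q%:R) * x)).
Proof.
apply: eq_cint => x _; rewrite /phi conjcM conj_expi conj_real.
rewrite (_ : kappa * (p%:R - q%:R) * x =
  (p%:R - 1) * kappa * x + - ((q%:R - 1) * kappa * x)); last by ring.
by rewrite expiD rmorphM /= mulrACA.
Qed.

Lemma Ed_lim (R : realType) (m N p l q j : nat) (e : R) : 0 < e ->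
  exists k0 : R, forall kappa, k0 <= kappa ->
  normc (ip (phi m N kappa p l) (phi m N kappa q j) -
    (if p == q then (gram R m N l j)%:C%C else 0)) <= e.
Proof.
move=> e0; have [->|pq] := eqVneq p q.
  exists 0 => kappa _; rewrite ip_phi -cint_real.
  rewrite [X in X - _](_ : _ = cint (fun x => (Bsp m N l x * Bsp m N j x)%:C%C)).
    by rewrite subrr Normc.normc0 ltW.
  by apply: eq_cint => x _; rewrite subrr mulr0 mul0r expi0 mulr1.
have bg : cbmeas (fun x : R => (Bsp m N l x * Bsp m N j x)%:C%C).
  by apply: cbmeas_real; apply: bmeasM; exact: bmeas_Bsp.
have [W WP] := RL_cint bg e0.
have c0 : p%:R - q%:R != 0 :> R by rewrite subr_eq0 eqr_nat.
exists (`|W| / `|p%:R - q%:R|) => w hw; rewrite ip_phi subr0; apply: WP.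
rewrite normrM -ler_pdivrMr ?normr_gt0//.
have := ler_norm w; have : W / `|p%:R - q%:R| <= `|W| / `|p%:R - q%:R|.
  by rewrite ler_wpM2r ?invr_ge0// ler_norm.
by lra.
Qed.

(** On each side of the diagonal the phase in [|s - t|] separates into an exponential in [s] and one
    in [t]. This gives two double integrals with frequencies in the scope of [cint2_lim]. *)
Lemma ip_Kop (R : realType) (K k : R -> R -> R[i]) (M : R) (m N : nat)
    (w : R) (p l q j : nat) :
  bkernel M k -> (forall s t, inI s -> inI t -> k s t = K s t) ->
  ip (Kop K w (phi m N w p l)) (phi m N w q j) =
  cint (fun s => (Bsp m N j s)%:C%C * expi (w * (2 - q%:R) * s) *
    cint (fun t => trik k m N true l s t * expi (w * (p%:R - 2) * t))) +
  cint (fun s => (Bsp m N j s)%:C%C * expi (w * (- q%:R) * s) *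
    cint (fun t => trik k m N false l s t * expi (w * p%:R * t))).
Proof.
move=> bk kK.
have bt b := bkernel_trik m N b l bk.
have bte b a : bkernel (2 ^+ m.-1 * M * 1)
    (fun s t => trik k m N b l s t * expi (w * a * t)).
  by apply: bkernelM => //; exact: bkernel_expi.
rewrite -cintD; last 2 first.
- apply: cbmeasM; last exact: cbmeas_cint2 (bte _ _).
  by apply: cbmeasM; [apply: cbmeas_real; exact: bmeas_Bsp|exact: cbmeas_expi].
- apply: cbmeasM; last exact: cbmeas_cint2 (bte _ _).
  by apply: cbmeasM; [apply: cbmeas_real; exact: bmeas_Bsp|exact: cbmeas_expi].
apply: eq_cint => s sI.
have -> : Kop K w (phi m N w p l) s =
    expi (w * s) * cint (fun t => trik k m N true l s t * expi (w * (p%:R - 2) * t)) +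
    expi (- (w * s)) * cint (fun t => trik k m N false l s t * expi (w * p%:R * t)).
  rewrite -!cintZ; [|exact: bkernel_section (bte _ _)..].
  have bs b a : cbmeas (fun t => trik k m N b l s t * expi (w * a * t)).
    exact: bkernel_section (bte _ _).
  have ce z : cbmeas (fun _ : R => z : R[i]) by split; exact: bmeas_cst.
  rewrite -cintD; [|exact: cbmeasM..].
  apply: eq_cint => t tI; rewrite /phi /trik -kK// /tri.
  case: (leP t s) => ts /=.
    rewrite ger0_norm ?subr_ge0// mul1r !mul0r mulr0 addr0.
    rewrite (_ : w * (s - t) = w * s + - (w * t)); last by ring.
    rewrite (_ : w * (p%:R - 2) * t = (p%:R - 1) * w * t + - (w * t)); last by ring.
    rewrite !expiD; ring.
  rewrite ler0_norm ?subr_le0 ?(ltW ts)// mul1r !mul0r mulr0 add0r.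
  rewrite (_ : w * - (s - t) = - (w * s) + w * t); last by ring.
  rewrite (_ : w * p%:R * t = (p%:R - 1) * w * t + w * t); last by ring.
  rewrite !expiD; ring.
rewrite /phi conjcM conj_expi conj_real.
rewrite (_ : w * (2 - q%:R) * s = w * s + - ((q%:R - 1) * w * s)); last by ring.
rewrite (_ : w * (- q%:R) * s = - (w * s) + - ((q%:R - 1) * w * s)); last by ring.
rewrite !expiD; ring.
Qed.

Lemma normc_sub3_le (R : realType) (x1 x2 x3 y1 y2 y3 : R[i]) (a b c : R) :
  normc (x1 - y1) <= a -> normc (x2 - y2) <= b -> normc (x3 - y3) <= c ->
  normc (x1 - (x2 + x3) - (y1 - (y2 + y3))) <= a + b + c.
Proof.
move=> a1 a2 a3.
rewrite (_ : x1 - (x2 + x3) - (y1 - (y2 + y3)) =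
  (x1 - y1) + (- (x2 - y2) + - (x3 - y3))); last by ring.
apply: le_trans (ler_normcD _ _) _.
apply: le_trans (lerD (lexx _) (ler_normcD _ _)) _.
rewrite !normc_opp; lra.
Qed.

Lemma entry_lim (R : realType) (K k : R -> R -> R[i]) (M : R)
    (m N p l q j : nat) (e : R) :
  bkernel M k -> (forall s t, inI s -> inI t -> k s t = K s t) -> 0 < e ->
  exists k0 : R, forall w, k0 <= w ->
  normc (ip (phi m N w p l) (phi m N w q j) -
    ip (Kop K w (phi m N w p l)) (phi m N w q j) -
    lim_entry k m N p l q j) <= e.
Proof.
move=> bk kK e0; have e3 : 0 < e / 3 by rewrite divr_gt0.
have bt b := bkernel_trik m N b l bk.
have [k1 h1] := Ed_lim m N p l q j e3.
have [k2 h2] := cint2_lim (p%:R - 2) (2 - q%:R) (bt true) (bmeas_Bsp R m N j) e3.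
have [k3 h3] := cint2_lim p%:R (- q%:R) (bt false) (bmeas_Bsp R m N j) e3.
exists (Num.max k1 (Num.max k2 k3)) => w; rewrite !ge_max => /and3P[w1 w2 w3].
have {h1} := h1 w w1; have {h2} := h2 w w2; have {h3} := h3 w w3.
rewrite oppr_eq0 !pnatr_eq0 !subr_eq0 eqr_nat (eq_sym 2) eqr_nat.
rewrite (ip_Kop _ _ _ _ _ _ _ bk kK) /lim_entry -/(volt k m N true l j)
  -/(volt k m N false l j).
move=> a3 a2 a1; apply: le_trans (normc_sub3_le a1 a2 a3) _.
by rewrite (_ : e / 3 + e / 3 + e / 3 = e)//; field.
Qed.

(** * Size and sparsity of the Gram and Volterra matrices *)

Lemma Bsp_neq0 (R : realType) (n N l : nat) (x : R) : Bsp n.+1 N l x != 0 ->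
  knot R n.+1 N l <= x < knot R n.+1 N (l + n.+1).
Proof. exact/bspl_support/knot_homo. Qed.

Lemma knot_bounds (R : realType) (m N i : nat) : (0 < N)%N ->
  -1 <= knot R m N i <= 1.
Proof.
move=> N0; have h0 := mesh_gt0 R N0.
have hN : mesh R N * N%:R = 2 by rewrite /mesh mulfVK// pnatr_eq0 -lt0n.
have h1 : 0 <= mesh R N * (minn N (i - m.-1))%:R by rewrite mulr_ge0// ltW.
have h2 : mesh R N * (minn N (i - m.-1))%:R <= 2.
  by rewrite -hN ler_pM2l// ler_nat geq_minl.
rewrite /knot; apply/andP; split; lra.
Qed.

(** A bound of the L^1 norm of a B-spline: the bound [2 ^+ n] of its values times the length of
    [n + 1] cells, which contain its support. It is linear in the mesh size. *)
Definition Bwidth (R : realType) (n N : nat) : R :=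
  2 ^+ n * (n.+1%:R * mesh R N).

Lemma intI_Bsp_le (R : realType) (n N l : nat) : (0 < N)%N ->
  intI (fun x : R => `|Bsp n.+1 N l x|) <= Bwidth R n N.
Proof.
move=> N0; have h0 := mesh_gt0 R N0.
set a := knot R n.+1 N l; set b := knot R n.+1 N (l + n.+1).
have /andP[a1 a2] : -1 <= a <= 1 by exact: knot_bounds.
have /andP[b1 b2] : -1 <= b <= 1 by exact: knot_bounds.
have bi : bmeas (\1_(`[a, b[%classic : set R) : R -> R).
  split; first exact: measurable_indic.
  by exists 1 => x _; rewrite indicE; case: (_ \in _); rewrite ?normr1 ?normr0.
apply: le_trans (_ : intI (fun x => 2 ^+ n * \1_(`[a, b[%classic : set R) x) <= _).
  apply: le_intI.
  - exact/bmeas_norm/bmeas_Bsp.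
  - by apply: bmeasM => //; exact: bmeas_cst.
  move=> x _; have [->|/Bsp_neq0 xab] := eqVneq (Bsp n.+1 N l x) 0.
    by rewrite normr0 mulr_ge0// indicE.
  rewrite indicE mem_set ?mulr1; first exact: Bsp_le.
  by rewrite /= in_itv.
rewrite intIZ// /Bwidth ler_wpM2l//.
rewrite /intI /Rintegral integral_indic//= setIidl; last first.
  by apply: subset_itv; rewrite bnd_simp.
rewrite lebesgue_measure_itv /= lte_fin; case: ifP => _ /=; last first.
  by rewrite mulr_ge0// ltW.
rewrite /a /b /knot addnS /=.
rewrite (_ : -1 + _ - _ = mesh R N * ((minn N ((l + n).+1 - n))%:R -
  (minn N (l - n))%:R)); last by ring.
rewrite mulrC ler_pM2r// lerBlDr -natrD ler_nat; lia.
Qed.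

Lemma gram_le (R : realType) (n N l j : nat) : (0 < N)%N ->
  `|gram R n.+1 N l j| <= 2 ^+ n * Bwidth R n N.
Proof.
move=> N0; apply: le_trans (_ : intI (fun x => 2 ^+ n * `|Bsp n.+1 N l x|) <= _).
  apply: norm_intI_le.
  - by apply: bmeasM; exact: bmeas_Bsp.
  - by apply: bmeasM; [exact: bmeas_cst|exact/bmeas_norm/bmeas_Bsp].
  by move=> x _; rewrite normrM mulrC ler_wpM2r// Bsp_le.
rewrite intIZ; last exact/bmeas_norm/bmeas_Bsp.
by rewrite ler_wpM2l// intI_Bsp_le.
Qed.

Lemma Bsp_disjoint (R : realType) (n N l j : nat) (x : R) : (l + n.+1 <= j)%N ->
  Bsp n.+1 N l x * Bsp n.+1 N j x = 0.
Proof.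
move=> lj; have [->|/Bsp_neq0/andP[_ x1]] := eqVneq (Bsp n.+1 N l x) 0.
  by rewrite mul0r.
have [->|/Bsp_neq0/andP[x2 _]] := eqVneq (Bsp n.+1 N j x) 0; first by rewrite mulr0.
have := lt_le_trans x1 (@knot_homo R n.+1 N _ _ lj).
by move=> /lt_le_trans/(_ x2); rewrite ltxx.
Qed.

Lemma gram_eq0 (R : realType) (n N l j : nat) :
  (l + n.+1 <= j)%N || (j + n.+1 <= l)%N -> gram R n.+1 N l j = 0.
Proof.
move=> lj; rewrite /gram (@eq_intI _ _ (fun=> 0)) ?intI_cst ?mul0r// => x _.
case/orP: lj => lj; first by rewrite Bsp_disjoint.
by rewrite mulrC Bsp_disjoint.
Qed.

Lemma cint0 (R : realType) : cint (fun _ : R => 0 : R[i]) = 0.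
Proof. by rewrite cintE /= intI_cst mul0r. Qed.

(** The supports are then ordered so that no point [t] of the one is on the required side of a point
    [s] of the other. On the side where a triangular matrix would vanish, only [n] diagonals
    survive. *)
Lemma volt_eq0 (R : realType) (k : R -> R -> R[i]) (n N : nat) (b : bool)
    (l j : nat) :
  (if b then j + n.+1 <= l else l + n.+1 <= j)%N -> volt k n.+1 N b l j = 0.
Proof.
move=> lj; rewrite /volt (@eq_cint _ _ (fun=> 0)) ?cint0// => s _.
have [->|/Bsp_neq0/andP[s1 s2]] := eqVneq (Bsp n.+1 N j s) 0; first by rewrite mul0r.
rewrite (@eq_cint _ _ (fun=> 0)) ?cint0 ?mulr0// => t _; rewrite /trik.
have [->|/Bsp_neq0/andP[t1 t2]] := eqVneq (Bsp n.+1 N l t) 0.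
  by rewrite mulr0 mul0r.
suff -> : tri b s t = 0 by rewrite mul0r mul0r.
rewrite /tri; case: b lj => lj.
  have st : s < t.
    exact: lt_le_trans s2 (le_trans (@knot_homo R n.+1 N _ _ lj) t1).
  by rewrite leNgt st.
have ts : t < s.
  exact: lt_le_trans t2 (le_trans (@knot_homo R n.+1 N _ _ lj) s1).
by rewrite ltW.
Qed.

(** Each of the two integrations gains the L^1 norm of a B-spline, hence the order h^2 against h for
    a Gram entry; each also costs the factor 2 of [normc_cint_le]. *)
Lemma volt_le (R : realType) (k : R -> R -> R[i]) (M : R) (n N : nat) (b : bool)
    (l j : nat) : (0 < N)%N -> bkernel M k ->
  normc (volt k n.+1 N b l j) <= 4 * M * Bwidth R n N ^+ 2.
Proof.
move=> N0 bk.
have M0 : 0 <= M by have [_ _ kM] := bk; exact: le_trans (normc_ge0 _) (kM 0 0).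
have W0 : 0 <= Bwidth R n N.
  by rewrite mulr_ge0// mulr_ge0// ltW// mesh_gt0.
have bt := bkernel_trik n.+1 N b l bk.
have bB j' := bmeas_norm (bmeas_Bsp R n.+1 N j').
have inner s : normc (cint (trik k n.+1 N b l s)) <= 2 * (M * Bwidth R n N).
  apply: le_trans (normc_cint_le (G := fun t => M * `|Bsp n.+1 N l t|) _ _ _) _.
  - exact: bkernel_section bt.
  - by apply: bmeasM; [exact: bmeas_cst|exact: bB].
  - move=> t _; rewrite /trik Normc.normcM normc_real normrM mulrC.
    have [_ _ kM] := bk; rewrite ler_pM ?normc_ge0// -[leRHS]mul1r.
    by rewrite ler_wpM2r// tri_le.
  by rewrite intIZ// ler_wpM2l// ler_wpM2l// intI_Bsp_le.
apply: le_trans (normc_cint_le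
  (G := fun s => 2 * (M * Bwidth R n N) * `|Bsp n.+1 N j s|) _ _ _) _.
- by apply: cbmeasM; [exact/cbmeas_real/bmeas_Bsp|exact: cbmeas_cint2 bt].
- by apply: bmeasM; [exact: bmeas_cst|exact: bB].
- by move=> s _; rewrite Normc.normcM normc_real mulrC ler_wpM2r.
rewrite intIZ//.
apply: le_trans (_ : 2 * (2 * (M * Bwidth R n N) * Bwidth R n N) <= _).
  by rewrite ler_wpM2l// ler_wpM2l ?intI_Bsp_le// !mulr_ge0.
by rewrite le_eqVlt; apply/orP; left; apply/eqP; ring.
Qed.

Lemma intI_sum (R : realType) (I : eqType) (r : seq I) (f : I -> R -> R) :
  (forall i, bmeas (f i)) ->
  bmeas (fun x => \sum_(i <- r) f i x) /\
  intI (fun x => \sum_(i <- r) f i x) = \sum_(i <- r) intI (f i).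
Proof.
move=> bf; elim: r => [|i r [IH1 IH2]].
  have -> : (fun x => \sum_(i <- [::]) f i x) = (fun=> 0).
    by apply/funext => x; rewrite big_nil.
  by split; [exact: bmeas_cst|rewrite big_nil intI_cst mul0r].
have -> : (fun x => \sum_(j <- i :: r) f j x) =
    (fun x => f i x + \sum_(j <- r) f j x).
  by apply/funext => x; rewrite big_cons.
by split; [exact: bmeasD|rewrite intID// IH2 big_cons].
Qed.

Lemma gram_form (R : realType) (m N : nat) (a : nat -> R) :
  intI (fun x => spline m N a x ^+ 2) =
  \sum_(l < dimS m N) \sum_(j < dimS m N) a l * a j * gram R m N l j.
Proof.
have bB l j : bmeas (fun x : R => Bsp m N l x * Bsp m N j x).
  by apply: bmeasM; exact: bmeas_Bsp.
have bt l j : bmeas (fun x : R => a l * a j * (Bsp m N l x * Bsp m N j x)).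
  by apply: bmeasM => //; exact: bmeas_cst.
rewrite (@eq_intI _ _ (fun x => \sum_(l < dimS m N) \sum_(j < dimS m N)
    a l * a j * (Bsp m N l x * Bsp m N j x))); last first.
  move=> x _; rewrite expr2 {1}/spline mulr_suml; apply: eq_bigr => l _.
  rewrite /spline mulr_sumr; apply: eq_bigr => j _; ring.
rewrite (intI_sum _ _).2; last by move=> l; exact: (intI_sum _ _).1.
apply: eq_bigr => l _; rewrite (intI_sum _ _).2//.
by apply: eq_bigr => j _; rewrite intIZ.
Qed.

(** * Schur-type matrix estimates *)

Definition sqn (R : realType) n (x : 'I_n -> R[i]) : R :=
  \sum_i normc (x i) ^+ 2.

Lemma sqn_ge0 (R : realType) n (x : 'I_n -> R[i]) : 0 <= sqn x.
Proof. by apply: sumr_ge0 => i _; exact: sqr_ge0. Qed.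

Lemma sum_normc (R : realType) (I : finType) (F : I -> R[i]) :
  normc (\sum_i F i) <= \sum_i normc (F i).
Proof.
elim/big_ind2: _ => [|x1 x2 y1 y2 h1 h2|//]; first by rewrite Normc.normc0.
by apply: le_trans (ler_normcD _ _) _; exact: lerD.
Qed.

(* Schur's test, with the inequality of arithmetic and geometric means of weight
   [a] in place of Cauchy-Schwarz. *)
Lemma schur_form (R : realType) n (e : 'I_n -> 'I_n -> R) (S : R)
    (x y : 'I_n -> R) (a : R) : 0 < a ->
  (forall i j, 0 <= e i j) ->
  (forall i, \sum_j e i j <= S) -> (forall j, \sum_i e i j <= S) ->
  \sum_i \sum_j e i j * (x i * y j) <=
  S * (a / 2 * (\sum_i x i ^+ 2) + a^-1 / 2 * (\sum_j y j ^+ 2)).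
Proof.
move=> a0 e0 row col.
apply: le_trans (_ : \sum_i \sum_j
    (e i j * (a / 2 * x i ^+ 2) + e i j * (a^-1 / 2 * y j ^+ 2)) <= _).
  apply: ler_sum => i _; apply: ler_sum => j _.
  rewrite -mulrDr ler_wpM2l//.
  have : 0 <= (a * x i - y j) ^+ 2 / (2 * a) by rewrite mulr_ge0 ?sqr_ge0// invr_ge0 mulr_ge0// ltW.
  suff -> : (a * x i - y j) ^+ 2 / (2 * a) =
      a / 2 * x i ^+ 2 + a^-1 / 2 * y j ^+ 2 - x i * y j by rewrite subr_ge0.
  by field; rewrite gt_eqF.
under eq_bigr do rewrite big_split /=.
rewrite big_split /= mulrDr; apply: lerD.
  rewrite !mulr_sumr; apply: ler_sum => i _.
  rewrite -mulr_suml ler_wpM2r// mulr_ge0 ?sqr_ge0// divr_ge0// ltW//.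
rewrite exchange_big !mulr_sumr; apply: ler_sum => j _ /=.
by rewrite -mulr_suml ler_wpM2r// mulr_ge0 ?sqr_ge0// divr_ge0// invr_ge0 ltW.
Qed.

Definition mulv (R : realType) n (A : 'I_n -> 'I_n -> R[i]) (x : 'I_n -> R[i])
    (i : 'I_n) : R[i] := \sum_j A i j * x j.

(** [y] is paired with itself: with the weight [1 / S] the form is at most
    [|y|^2 / 2 + S^2 |x|^2 / 2], and the first term is absorbed on the left. *)
Lemma schur_upper (R : realType) n (A : 'I_n -> 'I_n -> R[i])
    (e : 'I_n -> 'I_n -> R) (S : R) (x : 'I_n -> R[i]) : 0 < S ->
  (forall i j, normc (A i j) <= e i j) ->
  (forall i, \sum_j e i j <= S) -> (forall j, \sum_i e i j <= S) ->
  sqn (mulv A x) <= S ^+ 2 * sqn x.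
Proof.
move=> S0 Ae row col; set y := mulv A x.
have e0 i j : 0 <= e i j by exact: le_trans (normc_ge0 _) (Ae i j).
have iS : 0 < S^-1 by rewrite invr_gt0.
have := @schur_form R n e S (fun i => normc (y i)) (fun j => normc (x j)) S^-1 iS e0 row col.
rewrite -/(sqn x) -/(sqn y) => h.
have : sqn y <= \sum_i \sum_j e i j * (normc (y i) * normc (x j)).
  apply: ler_sum => i _; rewrite expr2 {1}/y /mulv.
  apply: le_trans (ler_wpM2r (normc_ge0 _) (sum_normc _)) _.
  rewrite mulr_suml; apply: ler_sum => j _; rewrite Normc.normcM.
  by rewrite -mulrA [normc (x j) * _]mulrC ler_wpM2r ?mulr_ge0 ?normc_ge0.
move=> /le_trans/(_ h).
rewrite (_ : S * _ = sqn y / 2 + S ^+ 2 / 2 * sqn x); last first.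
  by rewrite invrK; field; rewrite gt_eqF.
by rewrite -/(sqn y); move: (sqn y) (sqn x) => u v; nra.
Qed.

(* Pair [w A w^-1 z] with [z := w x]: the form [g] contributes at least
   [c |z|^2] and, by Schur's test, the remainder at most [S |z|^2]. *)
Lemma weighted_lower (R : realType) n (A : 'I_n -> 'I_n -> R[i])
    (g e : 'I_n -> 'I_n -> R) (w : 'I_n -> R) (c S L : R) (x : 'I_n -> R[i]) :
  S < c -> 0 < L ->
  (forall i, L^-1 <= w i) -> (forall i, w i <= L) ->
  (forall a : 'I_n -> R, c * (\sum_i a i ^+ 2) <= \sum_i \sum_j a i * a j * g i j) ->
  (forall i j, normc ((w i / w j)%:C%C * A i j - (g i j)%:C%C) <= e i j) ->
  (forall i, \sum_j e i j <= S) -> (forall j, \sum_i e i j <= S) ->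
  ((c - S) / L ^+ 2) ^+ 2 * sqn x <= sqn (mulv A x).
Proof.
move=> Sc L0 w1 w2 gP Ae row col.
have w0 i : 0 < w i by apply: lt_le_trans (w1 i); rewrite invr_gt0.
have e0 i j : 0 <= e i j by exact: le_trans (normc_ge0 _) (Ae i j).
pose z i := (w i)%:C%C * x i.
pose y i := (w i)%:C%C * mulv A x i.
pose E i j := (w i / w j)%:C%C * A i j - (g i j)%:C%C.
have yE i : y i = \sum_j (g i j)%:C%C * z j + \sum_j E i j * z j.
  rewrite -big_split /= /y /mulv mulr_sumr; apply: eq_bigr => j _.
  rewrite -mulrDl /E addrC subrK /z mulrACA; congr (_ * _).
  rewrite -rmorphM /=; congr (_%:C)%C.
  by rewrite mulfVK// gt_eqF.
pose re i := complex.Re (z i); pose im i := complex.Im (z i).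
have sqz i : normc (z i) ^+ 2 = re i ^+ 2 + im i ^+ 2.
  by rewrite /re /im; case: (z i) => a b /=; rewrite sqr_sqrtr// addr_ge0// sqr_ge0.
(* The real inner product of the complex plane, the real part of [u] times the conjugate of [v]. *)
pose ipr (u v : R[i]) := complex.Re u * complex.Re v + complex.Im u * complex.Im v.
have ipr_le u v : `|ipr u v| <= normc u * normc v.
  rewrite /ipr; have -> : complex.Re u * complex.Re v + complex.Im u * complex.Im v =
      complex.Re (u * conjc v) by case: u v => [a b] [a' b'] /=; ring.
  apply: le_trans (Re_le_normc _) _; rewrite Normc.normcM.
  suff -> : normc (conjc v) = normc v by [].
  by case: v => a b /=; rewrite sqrrN.
have iprD u v v' : ipr u (v + v') = ipr u v + ipr u v'.
  by case: u v v' => [a b] [a' b'] [a2 b2]; rewrite /ipr /=; ring.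
have ipr_sum u (F : 'I_n -> R[i]) : ipr u (\sum_j F j) = \sum_j ipr u (F j).
  elim/big_rec2: _ => [|j v v' _ <-]; last by rewrite iprD.
  by rewrite /ipr /= !mulr0 addr0.
(* Since [g] is real, its form splits into the forms at the real and at the imaginary parts of [z],
   and the coercivity over real vectors applies to both. *)
have low : c * sqn z <= \sum_i ipr (z i) (\sum_j (g i j)%:C%C * z j).
  have -> : \sum_i ipr (z i) (\sum_j (g i j)%:C%C * z j) =
      \sum_i \sum_j re i * re j * g i j + \sum_i \sum_j im i * im j * g i j.
    rewrite -big_split /=; apply: eq_bigr => i _; rewrite ipr_sum -big_split /=.
    apply: eq_bigr => j _; rewrite /ipr /re /im; case: (z i) (z j) => [a b] [a' b'] /=.
    ring.
  rewrite /sqn; under eq_bigr do rewrite sqz.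
  by rewrite big_split /= mulrDr lerD.
have err : - (S * sqn z) <= \sum_i ipr (z i) (\sum_j E i j * z j).
  have := @schur_form R n e S (fun i => normc (z i)) (fun j => normc (z j)) 1 ltr01 e0 row col.
  rewrite -/(sqn z) (_ : S * _ = S * sqn z); last by field.
  move=> h; rewrite lerNl; apply: le_trans h.
  rewrite -sumrN; apply: ler_sum => i _; rewrite ipr_sum -sumrN.
  apply: ler_sum => j _; apply: le_trans (ler_norm _) _; rewrite normrN.
  apply: le_trans (ipr_le _ _) _; rewrite (Normc.normcM (E i j)) [leLHS]mulrCA.
  by apply: ler_wpM2r; [rewrite mulr_ge0 ?normc_ge0|exact: Ae].
have key : (c - S) ^+ 2 * sqn z <= sqn y.
  have d0 : 0 < c - S by rewrite subr_gt0.
  (* The weight [c - S] lets half of the lower bound absorb the term in [z]. *)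
  have up : \sum_i ipr (z i) (y i) <= (c - S) / 2 * sqn z + (c - S)^-1 / 2 * sqn y.
    rewrite /sqn !mulr_sumr -big_split /=; apply: ler_sum => i _.
    apply: le_trans (ler_norm _) _; apply: le_trans (ipr_le _ _) _.
    move: (normc (z i)) (normc (y i)) => u v.
    have : 0 <= ((c - S) * u - v) ^+ 2 / (2 * (c - S)).
      by rewrite mulr_ge0 ?sqr_ge0// invr_ge0 mulr_ge0// ltW.
    suff -> : ((c - S) * u - v) ^+ 2 / (2 * (c - S)) =
        (c - S) / 2 * u ^+ 2 + (c - S)^-1 / 2 * v ^+ 2 - u * v by rewrite subr_ge0.
    by field; rewrite gt_eqF.
  have tot : (c - S) * sqn z <= \sum_i ipr (z i) (y i).
    under eq_bigr do rewrite yE iprD.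
    by rewrite big_split /= mulrBl lerD.
  have := le_trans tot up.
  rewrite -subr_ge0 => h.
  have : 0 <= (2 * (c - S)) * ((c - S) / 2 * sqn z + (c - S)^-1 / 2 * sqn y -
      (c - S) * sqn z) by rewrite mulr_ge0// mulr_ge0// ltW.
  suff -> : (2 * (c - S)) * ((c - S) / 2 * sqn z + (c - S)^-1 / 2 * sqn y -
      (c - S) * sqn z) = sqn y - (c - S) ^+ 2 * sqn z by rewrite subr_ge0.
  by field; rewrite gt_eqF.
have L20 : 0 < L ^+ 2 by rewrite exprn_gt0.
(* Undoing the weights costs [L ^+ 2] in the squared norm for [y] and again for [z], hence the
   division of [c - S] by [L ^+ 2]. *)
have yL : sqn y <= L ^+ 2 * sqn (mulv A x).
  rewrite /sqn mulr_sumr; apply: ler_sum => i _.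
  rewrite /y Normc.normcM exprMn ler_wpM2r ?sqr_ge0//.
  by rewrite normc_real gtr0_norm// lerXn2r// nnegrE ltW.
have zL : sqn x <= L ^+ 2 * sqn z.
  rewrite /sqn mulr_sumr; apply: ler_sum => i _.
  rewrite /z Normc.normcM exprMn mulrA -[leLHS]mul1r ler_wpM2r ?sqr_ge0//.
  rewrite normc_real gtr0_norm// -exprMn exprn_ege1//.
  by rewrite mulrC -ler_pdivrMr// mul1r.
rewrite expr_div_n mulrAC -exprM ler_pdivrMr ?exprn_gt0//.
apply: le_trans (_ : (c - S) ^+ 2 * (L ^+ 2 * sqn z) <= _).
  by rewrite ler_wpM2l// sqr_ge0.
apply: le_trans (_ : L ^+ 2 * (L ^+ 2 * sqn (mulv A x)) <= _).
  by rewrite mulrCA ler_wpM2l ?(ltW L20)// (le_trans key).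
by rewrite mulrA -exprD mulrC.
Qed.

(** * From two-sided quadratic bounds to the condition number *)

Lemma vnormE (R : realType) n (x : 'cV[R[i]]_n) :
  vnorm x = Num.sqrt (sqn (fun i => x i 0)).
Proof. by []. Qed.

Lemma vnorm_mulmx (R : realType) n (A : 'M[R[i]]_n) (x : 'cV[R[i]]_n) :
  vnorm (A *m x) = Num.sqrt (sqn (mulv (fun i j => A i j) (fun i => x i 0))).
Proof. by congr Num.sqrt; apply: eq_bigr => i _; rewrite mxE. Qed.

Lemma opnorm_le (R : realType) n (A : 'M[R[i]]_n) (U : R) : 0 <= U ->
  (forall x : 'cV[R[i]]_n, vnorm (A *m x) <= U * vnorm x) ->
  0 <= opnorm A <= U.
Proof.
move=> U0 AU; rewrite /opnorm; set E := [set r | _].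
(* Unit vectors are missing only when [n = 0]; the supremum of the empty set is 0 by convention. *)
have [->|/set0P E0] := eqVneq E set0; first by rewrite sup0 lexx.
have ub : ubound E U by move=> _ [x [x1 ->]]; rewrite -[U]mulr1 -x1.
rewrite ge_sup// andbT.
have [r Er] := E0.
apply: le_trans (_ : r <= _); first by case: Er => x [_ ->]; exact: sqrtr_ge0.
by apply: ub_le_sup => //; exists U.
Qed.

(** The lower bound gives injectivity, hence invertibility of the square matrix; applied to
    [invmx A *m x], it also bounds the inverse by [1 / L]. *)
Lemma Cond_le (R : realType) n (A : 'M[R[i]]_n) (U L : R) : 0 < U -> 0 < L ->
  (forall x, sqn (mulv (fun i j => A i j) x) <= U ^+ 2 * sqn x) ->
  (forall x, L ^+ 2 * sqn x <= sqn (mulv (fun i j => A i j) x)) ->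
  (Cond A <= (U / L)%:E)%E.
Proof.
move=> U0 L0 up low.
have low' (x : 'cV[R[i]]_n) : L * vnorm x <= vnorm (A *m x).
  rewrite vnorm_mulmx vnormE -[L]gtr0_norm// -sqrtr_sqr -sqrtrM ?sqr_ge0//.
  exact: ler_wsqrtr.
have up' (x : 'cV[R[i]]_n) : vnorm (A *m x) <= U * vnorm x.
  rewrite vnorm_mulmx vnormE -[U]gtr0_norm// -sqrtr_sqr -sqrtrM ?sqr_ge0//.
  exact: ler_wsqrtr.
have uA : A \in unitmx.
  rewrite -unitmx_tr -row_free_unit; apply: inj_row_free => v vA.
  have Av : A *m v^T = 0 by apply: trmx_inj; rewrite trmx_mul trmxK vA trmx0.
  have := low' v^T; rewrite Av.
  have -> : vnorm (0 : 'cV[R[i]]_n) = 0.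
    rewrite vnormE /sqn big1 ?sqrtr0// => i _.
    by rewrite mxE Normc.normc0 expr0n.
  rewrite pmulr_rle0// vnormE => h.
  have : sqn (fun i => v^T i 0) = 0.
    by apply/eqP; rewrite eq_le sqn_ge0 andbT -sqrtr_eq0 eq_le h sqrtr_ge0.
  move=> /eqP; rewrite psumr_eq0; last by move=> i _; exact: sqr_ge0.
  move=> /allP v0; apply/rowP => i; rewrite mxE.
  have := v0 i (mem_index_enum _); rewrite /= expf_eq0 /= => /eqP.
  by rewrite mxE; exact: Normc.eq0_normc.
rewrite /Cond uA lee_fin.
have /andP[q1 q2] := opnorm_le (ltW U0) up'.
have iL : 0 <= L^-1 by rewrite invr_ge0 ltW.
have : 0 <= opnorm (invmx A) <= L^-1.
  apply: opnorm_le => // x; rewrite mulrC ler_pdivlMr// mulrC.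
  by apply: le_trans (low' _) _; rewrite mulmxA mulmxV// mul1mx.
by move=> /andP[p1 p2]; exact: ler_pM.
Qed.

(** * Weights and the limit matrix *)

Lemma sum_blocks (R : realType) (P d : nat) (F : nat -> R) :
  \sum_(k < P * d) F k = \sum_(p < P) \sum_(l < d) F (p * d + l)%N.
Proof.
elim: P => [|P IH]; first by rewrite mul0n !big_ord0.
rewrite big_ord_recr /= -IH -!(big_mkord xpredT) (@big_cat_nat _ _ _ (P * d)%N)//=.
  congr (_ + _); rewrite -{1}[(P * d)%N]add0n big_addn mulSn addnK !big_mkord.
  by apply: eq_bigr => i _; rewrite addnC.
by rewrite leq_mul2r leqnSn orbT.
Qed.

Lemma sum_divmod (R : realType) (P d : nat) (f : nat -> nat -> R) : (0 < d)%N ->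
  \sum_(k < P * d) f (k %/ d)%N (k %% d)%N = \sum_(p < P) \sum_(l < d) f p l.
Proof.
move=> d0; rewrite (@sum_blocks R P d (fun k => f (k %/ d)%N (k %% d)%N)).
apply: eq_bigr => p _; apply: eq_bigr => l _.
by rewrite divnMDl// divn_small// addn0 modnMDl modn_small.
Qed.

Lemma geom_sum_le (R : realType) (r : R) (d : nat) : 0 <= r -> r < 1 ->
  \sum_(j < d) r ^+ j <= (1 - r)^-1.
Proof.
move=> r0 r1; have s0 : 0 < 1 - r by rewrite subr_gt0.
rewrite -[leRHS]mul1r ler_pdivlMr// mulrC.
have := subrX1 r d; rewrite -opprB => /(congr1 -%R); rewrite opprK -mulNr opprB => <-.
by rewrite lerBlDr lerDl exprn_ge0.
Qed.

(** The distance |l - j|: at least one of the two truncated differences is 0. *)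
Definition ndist (l j : nat) : nat := (l - j + (j - l))%N.

Lemma ndistC (l j : nat) : ndist l j = ndist j l.
Proof. by rewrite /ndist addnC. Qed.

Lemma sum_ndist_le (R : realType) (r : R) (d l : nat) : 0 <= r -> r < 1 ->
  \sum_(j < d) r ^+ ndist l j <= 2 / (1 - r).
Proof.
move=> r0 r1.
(* The longer range splits at [l] into two one-sided geometric sums, wherever [l] lies with respect
   to [d]. *)
apply: le_trans (_ : \sum_(j < l + d) r ^+ ndist l j <= _).
  rewrite -!(big_mkord xpredT (fun j => r ^+ ndist l j)).
  rewrite (@big_cat_nat _ _ _ d 0 (l + d)) ?leq_addl//= lerDl.
  by apply: sumr_ge0 => j _; exact: exprn_ge0.
rewrite big_split_ord /= mulr2n mulrDl mul1r; apply: lerD.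
  rewrite (reindex_inj rev_ord_inj) /=.
  apply: le_trans (geom_sum_le l r0 r1); apply: ler_sum => j _.
  have -> : ndist l (l - j.+1) = j.+1 by rewrite /ndist; have := ltn_ord j; lia.
  by rewrite exprS ler_piMl ?exprn_ge0// ltW.
apply: le_trans (geom_sum_le d r0 r1); apply: ler_sum => j _.
by rewrite /ndist (_ : (_ + _)%N = j)//; lia.
Qed.

Definition wratio (R : realType) (x : R) (l j : nat) : R :=
  (1 + x) ^+ l / (1 + x) ^+ j.

Lemma wratioE (R : realType) (x : R) (l j : nat) : 0 <= x ->
  wratio x l j = if (j <= l)%N then (1 + x) ^+ ndist l j
                 else ((1 + x)^-1) ^+ ndist l j.
Proof.
move=> x0; have nz : 1 + x != 0 by rewrite gt_eqF// ltr_pwDl.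
rewrite /wratio; case: leqP => lj.
  by rewrite -expfB_cond ?(negbTE nz)// /ndist (eqP lj) addn0.
rewrite /ndist (_ : (l - j = 0)%N) ?add0n; last by apply/eqP; rewrite subn_eq0 ltnW.
by rewrite exprVn expfB// invf_div.
Qed.

(** By convexity [(1 + x)^m] stays below its chord [1 + (2^m - 1) x] on [0, 1]; the induction
    propagates the chord because [x^2 <= x]. *)
Lemma pow1D_le (R : realType) (x : R) (k m : nat) : 0 <= x <= 1 -> (k <= m)%N ->
  1 <= (1 + x) ^+ k <= 1 + 2 ^+ m * x.
Proof.
move=> /andP[x0 x1] km; have q1 : 1 <= 1 + x by rewrite lerDl.
rewrite exprn_ege1//=; apply: le_trans (ler_weXn2l q1 km) _.
suff : (1 + x) ^+ m <= 1 + (2 ^+ m - 1) * x.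
  by move=> h; apply: le_trans h _; rewrite lerD2l ler_wpM2r// lerBlDr lerDl.
elim: m {km} => [|m IH]; first by rewrite !expr0 subrr mul0r addr0.
rewrite exprS; apply: le_trans (ler_wpM2l _ IH) _; first by lra.
have p1 : 1 <= (2 : R) ^+ m by rewrite exprn_ege1// ler1n.
rewrite [2 ^+ m.+1]exprS.
have xx : x * x <= x by rewrite ler_piMl.
have : (2 ^+ m - 1) * (x * x) <= (2 ^+ m - 1) * x by rewrite ler_wpM2l// subr_ge0.
by move: (2 ^+ m) p1 => u p1; lra.
Qed.

(** Inside the band that carries the Gram matrix, conjugation multiplies an entry by a factor within
    O(x) of 1. *)
Lemma wratio_near (R : realType) (x : R) (l j m : nat) : 0 <= x <= 1 ->
  (ndist l j <= m)%N ->
  [/\ 0 <= wratio x l j, wratio x l j <= 2 ^+ m & `|wratio x l j - 1| <= 2 ^+ m * x].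
Proof.
move=> x01 hm; have /andP[h1 h2] := pow1D_le x01 hm.
have /andP[x0 x1] := x01.
have q0 : 0 < 1 + x by rewrite ltr_pwDl.
have h3 : (1 + x) ^+ ndist l j <= 2 ^+ m.
  have q1 : 1 <= 1 + x by rewrite lerDl.
  apply: le_trans (ler_weXn2l q1 hm) _; apply: lerXn2r; rewrite ?nnegrE ?(ltW q0)//.
  by lra.
rewrite wratioE//; case: ifP => _; split=> //.
- by rewrite exprn_ge0// ltW.
- by rewrite ger0_norm ?subr_ge0//; lra.
- by rewrite exprn_ge0// invr_ge0 ltW.
- rewrite exprVn; apply: le_trans (_ : 1 <= _); last exact: le_trans h1 h3.
  by rewrite invf_le1// exprn_gt0.
rewrite exprVn; move: ((1 + x) ^+ _) h1 h2 {h3} => u u1 u2.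
have u0 : 0 < u by exact: lt_le_trans u1.
rewrite distrC ger0_norm; last by rewrite subr_ge0 invf_le1.
apply: le_trans (_ : u - 1 <= _); last by lra.
(* For an inverse power: [1 - 1 / u <= u - 1] when [u >= 1]. *)
have : 0 <= (u - 1) * (1 - u^-1) by rewrite mulr_ge0 ?subr_ge0 ?invf_le1.
rewrite (_ : (u - 1) * (1 - u^-1) = u - 2 + u^-1); first by lra.
by field; rewrite gt_eqF.
Qed.

(** In block 2 the Volterra matrix sits, up to [n] diagonals, where [l <= j], and the ratio
    [(1 + x)^(l - j)] damps it there. Block 0 is the mirror image, and block 1 has a Gram matrix
    alone in the limit. *)
Definition wgt (R : realType) (x : R) (p l : nat) : R :=
  if p == 2%N then (1 + x) ^+ l else if p == 0%N then ((1 + x) ^+ l)^-1 else 1.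

Lemma wgt_ratio (R : realType) (x : R) (p l j : nat) : wgt x p l / wgt x p j =
  if p == 2%N then wratio x l j else if p == 0%N then wratio x j l else 1.
Proof.
rewrite /wgt; case: ifP => // _; case: ifP => _; last by rewrite divr1.
by rewrite /wratio invrK mulrC.
Qed.

Lemma Bwidth_ge0 (R : realType) (n N : nat) : (0 < N)%N -> 0 <= Bwidth R n N.
Proof. by move=> N0; rewrite mulr_ge0// mulr_ge0// ltW// mesh_gt0. Qed.

(** Serves to dominate a band of half-width [m] by a geometric decay of ratio 1/2, so that banded
    and exponentially decaying matrices are summed in the same way. *)
Lemma half_pow_ge (R : realType) (i m : nat) : (i <= m)%N ->
  1 <= 2 ^+ m * (2^-1) ^+ i :> R.
Proof.
move=> im; rewrite exprVn ler_pdivlMr ?exprn_gt0// mul1r ler_weXn2l//.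
by rewrite ler1n.
Qed.

Lemma normc_if_add_le (R : realType) (b1 b2 : bool) (z1 z2 : R[i]) (s g : R) :
  ~~ (b1 && b2) -> 0 <= g -> (b1 -> s * normc z1 <= g) -> (b2 -> s * normc z2 <= g) ->
  s * normc ((if b1 then z1 else 0) + (if b2 then z2 else 0)) <= g.
Proof.
case: b1; case: b2 => // _ g0 h1 h2.
- by rewrite addr0 h1.
- by rewrite add0r h2.
- by rewrite addr0 Normc.normc0 mulr0.
Qed.

Lemma normc_volt_sum_le (R : realType) (k : R -> R -> R[i]) (M : R)
    (n N p l j : nat) : (0 < N)%N -> bkernel M k ->
  normc ((if p == 2%N then volt k n.+1 N true l j else 0) +
         (if p == 0%N then volt k n.+1 N false l j else 0)) <=
  4 * M * Bwidth R n N ^+ 2.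
Proof.
move=> N0 bk.
have v0 c := volt_le n c l j N0 bk.
rewrite -[leLHS]mul1r; apply: normc_if_add_le.
- by case: p => [|[|[]]].
- exact: le_trans (normc_ge0 _) (v0 true).
- by rewrite mul1r.
- by rewrite mul1r.
Qed.

(** For the upper bound the Volterra part needs no decay: a row of O(1/h) entries of size O(h^2)
    already sums to O(h). *)
Lemma normc_lim_entry_le (R : realType) (k : R -> R -> R[i]) (M : R)
    (n N p l q j : nat) : (0 < N)%N -> bkernel M k ->
  normc (lim_entry k n.+1 N p l q j) <=
  if p == q then 2 ^+ n * Bwidth R n N * (2 ^+ n * (2^-1) ^+ ndist l j) +
    4 * M * Bwidth R n N ^+ 2 else 0.
Proof.
move=> N0 bk; set b := Bwidth R n N; set ga := 4 * M * b ^+ 2.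
have b0 : 0 <= b by exact: Bwidth_ge0.
have M0 : 0 <= M by have [_ _ kM] := bk; exact: le_trans (normc_ge0 _) (kM 0 0).
have ga0 : 0 <= ga by rewrite !mulr_ge0// sqr_ge0.
rewrite /lim_entry; case: (eqVneq p q) => [<-|pq]; last first.
  have -> : (p == 2%N) && (q == 2%N) = false.
    by apply/negbTE; apply: contraNN pq => /andP[/eqP-> /eqP->].
  have -> : (p == 0%N) && (q == 0%N) = false.
    by apply/negbTE; apply: contraNN pq => /andP[/eqP-> /eqP->].
  by rewrite addr0 subr0 Normc.normc0.
rewrite !andbb; apply: le_trans (ler_normcD _ _) _; rewrite normc_opp normc_real.
apply: lerD; last exact: normc_volt_sum_le.
have [h|h] := leqP (ndist l j) n.
  apply: le_trans (gram_le R n l j N0) _; rewrite -/b.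
  by rewrite -[leLHS]mulr1 ler_wpM2l ?mulr_ge0// half_pow_ge.
rewrite gram_eq0 ?normr0.
  by rewrite !mulr_ge0// exprn_ge0// invr_ge0.
by move: h; rewrite /ndist; lia.
Qed.

(** Inside the band the Gram entry moves by O(x h) and the Volterra entry grows by at most [2 ^+ n].
    Outside it the Gram entry is 0, while the Volterra entry either vanishes, on the far side, or is
    damped by [(1 + x)^-1] to the power |l - j|. *)
Lemma conj_entry_le (R : realType) (k : R -> R -> R[i]) (M : R)
    (n N p l q j : nat) (x : R) : (0 < N)%N -> bkernel M k -> 0 <= x <= 1 ->
  normc ((wgt x p l / wgt x q j)%:C%C * lim_entry k n.+1 N p l q j -
    (if p == q then gram R n.+1 N l j else 0)%:C%C) <=
  if p == q then
    (2 ^+ n * x * (2 ^+ n * Bwidth R n N) + 2 ^+ n * (4 * M * Bwidth R n N ^+ 2)) *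
      (2 ^+ n * (2^-1) ^+ ndist l j) +
    4 * M * Bwidth R n N ^+ 2 * ((1 + x)^-1) ^+ ndist l j
  else 0.
Proof.
move=> N0 bk x01; set b := Bwidth R n N; set ga := 4 * M * b ^+ 2.
have b0 : 0 <= b by exact: Bwidth_ge0.
have M0 : 0 <= M by have [_ _ kM] := bk; exact: le_trans (normc_ge0 _) (kM 0 0).
have ga0 : 0 <= ga by rewrite !mulr_ge0// sqr_ge0.
have := @normc_lim_entry_le R k M n N p l q j N0 bk.
case: (eqVneq p q) => [<- _|_ h0]; last first.
  rewrite (_ : lim_entry _ _ _ _ _ _ _ = 0) ?mulr0 ?subr0 ?Normc.normc0//.
  apply: Normc.eq0_normc; apply/eqP; rewrite eq_le h0; exact: normc_ge0.
have /andP[x0 x1] := x01.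
have q0 : 0 < 1 + x by rewrite ltr_pwDl.
have r0 : 0 <= (1 + x)^-1 by rewrite invr_ge0 ltW.
rewrite /lim_entry eqxx !andbb wgt_ratio.
set rho := if p == 2%N then _ else _.
set v := (X in _%:C%C - X).
rewrite (_ : rho%:C%C * ((gram R n.+1 N l j)%:C%C - v) - (gram R n.+1 N l j)%:C%C =
  ((rho - 1) * gram R n.+1 N l j)%:C%C - rho%:C%C * v); last first.
  by rewrite rmorphM rmorphB rmorph1 /=; ring.
apply: le_trans (ler_normcD _ _) _.
rewrite normc_opp Normc.normcM !normc_real normrM.
have vg : normc v <= ga by exact: normc_volt_sum_le.
have [h|h] := leqP (ndist l j) n.
  have [rho0 rho1 rho2] : [/\ 0 <= rho, rho <= 2 ^+ n & `|rho - 1| <= 2 ^+ n * x].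
    rewrite /rho; case: ifP => _; first exact: wratio_near.
    case: ifP => _; first by apply: wratio_near => //; rewrite ndistC.
    by split; rewrite ?subrr ?normr0 ?mulr_ge0// exprn_ege1// ler1n.
  apply: le_trans (_ : 2 ^+ n * x * (2 ^+ n * b) + 2 ^+ n * ga <= _).
    apply: lerD; apply: ler_pM => //; rewrite ?normc_ge0//.
      exact: (gram_le R n l j N0).
    by rewrite ger0_norm.
  rewrite -[leLHS]addr0; apply: lerD; last by rewrite mulr_ge0// exprn_ge0.
  rewrite -[leLHS]mulr1 ler_wpM2l ?half_pow_ge// addr_ge0// !mulr_ge0//.
rewrite gram_eq0; last by move: h; rewrite /ndist; lia.
rewrite normr0 mulr0 add0r.
apply: le_trans (_ : ga * (1 + x)^-1 ^+ ndist l j <= _); last first.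
  rewrite lerDr !mulr_ge0 ?exprn_ge0 ?invr_ge0// addr_ge0// !mulr_ge0//.
have gr0 : 0 <= ga * (1 + x)^-1 ^+ ndist l j by rewrite mulr_ge0// exprn_ge0.
apply: normc_if_add_le => // [|/eqP p2|/eqP p0].
- by case: (p) => [|[|[]]].
- have [lj|lj] := leqP (j + n.+1) l.
    by rewrite (@volt_eq0 _ _ _ _ true)// Normc.normc0 mulr0.
  have -> : rho = wratio x l j by rewrite /rho p2.
  rewrite wratioE// (_ : (j <= l)%N = false); last first.
    by move: h; rewrite /ndist; lia.
  by rewrite ger0_norm ?exprn_ge0// mulrC; apply: ler_wpM2r;
    [rewrite exprn_ge0|exact: volt_le].
have [lj|lj] := leqP (l + n.+1) j.
  by rewrite (@volt_eq0 _ _ _ _ false)// Normc.normc0 mulr0.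
have -> : rho = wratio x j l by rewrite /rho p0.
rewrite wratioE// (_ : (l <= j)%N = false); last first.
  by move: h; rewrite /ndist; lia.
rewrite ndistC ger0_norm ?exprn_ge0// mulrC; apply: ler_wpM2r;
  [by rewrite exprn_ge0|exact: volt_le].
Qed.

(** * Assembly: uniform row sums and choice of the constants *)

Lemma finite_eventually (R : realType) (I : finType) (P : I -> R -> Prop) :
  (forall i, exists k0 : R, forall w, k0 <= w -> P i w) ->
  exists k0 : R, forall w, k0 <= w -> forall i, P i w.
Proof.
move=> /choice[f fP]; exists (\sum_i `|f i|) => w hw i; apply: fP.
apply: le_trans hw; rewrite (bigD1 i) //=.
have := ler_norm (f i); have : 0 <= \sum_(j | j != i) `|f j| by exact: sumr_ge0.
lra.
Qed.

Lemma dimSE (n N : nat) : dimS n.+1 N = (N + n)%N.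
Proof. by rewrite /dimS addnS. Qed.

Lemma dimS_le (n N : nat) : (0 < N)%N -> (dimS n.+1 N <= N * n.+1)%N.
Proof. by move=> N0; rewrite dimSE mulnS leq_add2l leq_pmull. Qed.

Lemma sum_half_ndist_le (R : realType) (d l : nat) :
  \sum_(j < d) (2^-1 : R) ^+ ndist l j <= 4.
Proof.
have h0 : 0 <= 2^-1 :> R by rewrite invr_ge0.
have h1 : 2^-1 < 1 :> R by lra.
apply: le_trans (sum_ndist_le d l h0 h1) _.
rewrite (_ : 1 - 2^-1 = 2^-1 :> R); last by field.
by rewrite invrK -natrM.
Qed.

Lemma sum_affine (R : realType) (d : nat) (a c g : R) (f : nat -> R) :
  \sum_(j < d) (a * (c * f j) + g) = a * (c * \sum_(j < d) f j) + g * d%:R.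
Proof. by rewrite big_split /= -!mulr_sumr sumr_const card_ord mulr_natr. Qed.

Lemma normc_mulB_le (R : realType) (c a l g : R[i]) :
  normc (c * a - g) <= normc (c * l - g) + normc c * normc (a - l).
Proof.
rewrite -Normc.normcM (_ : c * a - g = (c * l - g) + c * (a - l)); last by ring.
exact: ler_normcD.
Qed.

Lemma gram_block_form (R : realType) (n N : nat) (c : R) (a : nat -> R) :
  (forall a : nat -> R, c * (\sum_(l < dimS n.+1 N) a l ^+ 2) <=
    intI (fun x => spline n.+1 N a x ^+ 2)) ->
  c * (\sum_(k < 3 * dimS n.+1 N) a k ^+ 2) <=
  \sum_(k < 3 * dimS n.+1 N) \sum_(k' < 3 * dimS n.+1 N) a k * a k' *
    (if (k %/ dimS n.+1 N == k' %/ dimS n.+1 N)%N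
     then gram R n.+1 N (k %% dimS n.+1 N) (k' %% dimS n.+1 N) else 0).
Proof.
set d := dimS n.+1 N => H.
have dm p l : (l < d)%N -> ((p * d + l) %/ d = p)%N /\ ((p * d + l) %% d = l)%N.
  move=> ld; have d0 : (0 < d)%N by lia.
  by rewrite divnMDl// divn_small// addn0 modnMDl modn_small.
rewrite (sum_blocks 3 d (fun k => a k ^+ 2)).
rewrite (sum_blocks 3 d (fun k => \sum_(k' < 3 * d) a k * a k' *
    (if (k %/ d == k' %/ d)%N then gram R n.+1 N (k %% d) (k' %% d) else 0))).
rewrite mulr_sumr; apply: ler_sum => p _.
apply: le_trans (H (fun l => a (p * d + l)%N)) _; rewrite gram_form -/d.
rewrite le_eqVlt; apply/orP; left; apply/eqP; apply: eq_bigr => l _.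
rewrite (sum_blocks 3 d (fun k' => a (p * d + l)%N * a k' *
    (if ((p * d + l) %/ d == k' %/ d)%N
     then gram R n.+1 N ((p * d + l) %% d) (k' %% d) else 0))).
rewrite (bigD1 p) //= [X in _ = _ + X]big1 ?addr0.
  apply: eq_bigr => j _; have [-> ->] := dm p l (ltn_ord l).
  by have [-> ->] := dm p j (ltn_ord j); rewrite eqxx.
move=> q qp; apply: big1 => j _; have [-> _] := dm p l (ltn_ord l).
have [-> _] := dm q j (ltn_ord j); rewrite ifF ?mulr0//.
by apply/negbTE; rewrite eq_sym.
Qed.

Lemma row_sum_le (R : realType) (d : nat) (E : nat -> R) (S : R)
    (i : 'I_(3 * d)) : (forall t, 0 <= E t) ->
  (forall l, \sum_(j < d) E (ndist l j) <= S) ->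
  \sum_(j < 3 * d) (if (i %/ d == j %/ d)%N then E (ndist (i %% d) (j %% d)) else 0)
    <= S.
Proof.
move=> E0 ES; have d0 : (0 < d)%N by rewrite lt0n; apply/eqP => d0; case: i => i; rewrite d0.
rewrite (sum_divmod 3 (fun q j => if (i %/ d == q)%N then E (ndist (i %% d) j) else 0) d0).
have pi : (i %/ d < 3)%N by rewrite ltn_divLR.
rewrite (bigD1 (Ordinal pi)) //= eqxx [X in _ + X]big1 ?addr0//.
move=> q qi; apply: big1 => j _; rewrite ifF//.
by apply: contraNF qi => /eqP h; apply/eqP/val_inj.
Qed.

Lemma expR_pow_ge (R : realType) (x y : R) (l : nat) : 0 <= x -> x * l%:R <= y ->
  (1 + x) ^+ l <= expR y.
Proof.
move=> x0 xl; apply: le_trans (_ : expR x ^+ l <= _).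
  by rewrite lerXn2r ?nnegrE ?expR_ge0 ?expR_ge1Dx// addr_ge0.
by rewrite -expRM_natr ler_expR.
Qed.

(** From [1 + x <= exp x]. In the application [x] is proportional to the mesh size and [l] is below
    the dimension, so [y] can be taken independent of the mesh. *)
Lemma wgt_bounds (R : realType) (x y : R) (p l : nat) : 0 <= x -> x * l%:R <= y ->
  (expR y)^-1 <= wgt x p l <= expR y.
Proof.
move=> x0 xl; have h1 := expR_pow_ge x0 xl.
have y0 : 0 <= y by apply: le_trans xl; rewrite mulr_ge0.
have h2 : 1 <= (1 + x) ^+ l by rewrite exprn_ege1// lerDl.
have h3 : 1 <= expR y by exact: le_trans h2 h1.
have h4 : (expR y)^-1 <= 1 by rewrite invf_le1// expR_gt0.
have p0 : 0 < (1 + x) ^+ l by exact: lt_le_trans h2.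
rewrite /wgt; case: ifP => _; first by rewrite h1 andbT (le_trans h4).
case: ifP => _; last by rewrite h4 h3.
by rewrite lef_pV2 ?posrE ?expR_gt0// h1 /= (le_trans _ h3)// invf_le1.
Qed.

Theorem theorem7p2 (R : realType) (m : nat) (K : R -> R -> R[i]) :
  (0 < m)%N ->
  Cm_I2 m K ->
  (forall kappa : R, 1 < kappa -> one_not_eigenvalue K kappa) ->
  exists c h0 : R, 0 < h0 /\
    forall N : nat, (0 < N)%N -> mesh R N < h0 ->
      exists kappa0 : R, forall kappa : R, 1 < kappa -> kappa0 <= kappa ->
        (Cond (Ed m N kappa - Kd K m N kappa) <= c%:E)%E.
Proof.
case: m => // n _ /Cm_I2_kernel[M [k [bk kK]]] _.
have M0 : 0 <= M by have [_ _ kM] := bk; exact: le_trans (normc_ge0 _) (kM 0 0).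
have [c1 c10 stab] := Bsp_stable R n.
pose D : R := 2 ^+ n.
pose b : R := D * n.+1%:R.
have D1 : 1 <= D by rewrite exprn_ege1// ler1n.
have b1 : 0 < b by rewrite mulr_gt0// (lt_le_trans _ D1).
(* The damped Volterra part has row sums at most [4 M (b h)^2] times [4 / (lam h)], that is
   [16 M b^2 h / lam]; this choice brings them below [c1 h / 8], and the added 1 keeps [lam]
   positive. *)
pose lam : R := 128 * M * b ^+ 2 / c1 + 1.
have D0 : 0 <= D := le_trans ler01 D1.
have b0 : 0 <= b := ltW b1.
have b20 : 0 <= b ^+ 2 by exact: sqr_ge0.
have Mb0 : 0 <= 4 * M * b ^+ 2 by rewrite mulr_ge0// mulr_ge0.
have lam0 : 0 < lam.
  by rewrite ltr_wpDl// divr_ge0 ?(ltW c10)// mulr_ge0// mulr_ge0.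
have lam0' := ltW lam0.
(* The part of the conjugated remainder that comes from the band has row sums at most [4 Q h^2]. *)
pose Q : R := (D * lam * (D * b) + D * (4 * M * b ^+ 2)) * D.
have Q0 : 0 <= Q.
  rewrite /Q; apply: mulr_ge0 => //; apply: addr_ge0; last exact: mulr_ge0.
  by apply: mulr_ge0; apply: mulr_ge0.
(* Bounds the weights and their inverses, as [h] times the dimension is at most [2 (n + 1)]. *)
pose L : R := expR (lam * (2 * n.+1%:R)).
have L0 : 0 < L by exact: expR_gt0.
have L20 : 0 < L ^+ 2 by exact: exprn_gt0.
have L1 : 1 <= L.
  by apply: le_trans (expR_ge1Dx _); rewrite lerDl !mulr_ge0// ltW.
(* Row sums divided by [h]: the banded Gram part, the Volterra entries [4 M (b h)^2] counted with
   [h d <= 2 (n + 1)], and [c1] for the distance to the limit matrix. *)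
pose CU : R := D * b * D * 4 + 8 * n.+1%:R * M * b ^+ 2 + c1.
have CU0 : 0 < CU.
  by rewrite ltr_wpDl// addr_ge0// !mulr_ge0.
(* The quotient of the upper bound [CU h] by the lower bound [c1 h / (2 L^2)]. The threshold ensures
   [lam h <= 1], as the chord bound requires, and [4 Q h^2 <= c1 h / 8]. *)
exists (CU / (c1 / 2 / L ^+ 2)), (Num.min lam^-1 (c1 / (32 * (Q + 1)))).
split.
  by rewrite lt_min invr_gt0 lam0 divr_gt0// mulr_gt0// ltr_wpDl.
move=> N N0; rewrite lt_min => /andP[hlam hQ].
have h0 := mesh_gt0 R N0; set h := mesh R N in h0 hlam hQ.
have hN : h * N%:R = 2 by rewrite /h /mesh mulfVK// pnatr_eq0 -lt0n.
pose d := dimS n.+1 N.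
have d0 : (0 < d)%N by rewrite /d dimSE addn_gt0 N0.
have dR : 0 < d%:R :> R by rewrite ltr0n.
have hd : h * d%:R <= 2 * n.+1%:R.
  have -> : 2 * n.+1%:R = h * (N%:R * n.+1%:R) by rewrite mulrA hN.
  by rewrite ler_wpM2l ?(ltW h0)// -natrM ler_nat; exact: dimS_le.
have xle : 0 <= lam * h <= 1.
  rewrite mulr_ge0 ?(ltW lam0) ?(ltW h0)//=.
  by rewrite mulrC -ler_pdivlMr// mul1r ltW.
pose x := lam * h.
have x0 : 0 < x by rewrite mulr_gt0.
have x1 : x <= 1 by case/andP: xle.
have bE : Bwidth R n N = b * h by rewrite /Bwidth -/h /b /D mulrA.
(* Conjugation enlarges an entry by at most [L ^+ 2] and a row has [3 d] entries, so with this
   tolerance the passage to the limit costs [c1 h / 8] in the row sums. *)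
pose eps : R := c1 * h / (8 * (3 * d)%:R * L ^+ 2).
have nd0 : 0 < (3 * d)%:R :> R by rewrite ltr0n muln_gt0.
have eps0 : 0 < eps.
  apply: divr_gt0; first exact: mulr_gt0.
  by apply: mulr_gt0 => //; apply: mulr_gt0.
have ch0 : 0 < c1 * h := mulr_gt0 c10 h0.
have epsL : (3 * d)%:R * (L ^+ 2 * eps) = c1 * h / 8.
  by rewrite /eps; field; rewrite !gt_eqF.
have epsle : (3 * d)%:R * eps <= c1 * h.
  apply: le_trans (_ : (3 * d)%:R * (L ^+ 2 * eps) <= _).
    rewrite ler_wpM2l ?(ltW nd0)// -[leLHS]mul1r ler_wpM2r ?(ltW eps0)//.
    exact: exprn_ege1.
  by rewrite epsL ler_pdivrMr// ler_peMr// ?ler1n// ltW.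
pose A w (i j : 'I_(3 * d)) := (Ed n.+1 N w - Kd K n.+1 N w) i j.
pose Lm (i j : 'I_(3 * d)) :=
  lim_entry k n.+1 N (i %/ d) (i %% d) (j %/ d) (j %% d).
have [k0 hk] : exists k0 : R, forall w, k0 <= w ->
    forall ij : 'I_(3 * d) * 'I_(3 * d),
    normc (A w ij.1 ij.2 - Lm ij.1 ij.2) <= eps.
  apply: finite_eventually => -[i j].
  have [k0 hk0] := entry_lim n.+1 N (i %/ d) (i %% d) (j %/ d) (j %% d) bk kK eps0.
  by exists k0 => w /hk0; rewrite /A !mxE.
exists k0 => w _ /hk hA {hk}.
pose g (i j : 'I_(3 * d)) := if (i %/ d == j %/ d)%N
  then gram R n.+1 N (i %% d) (j %% d) else 0.
pose al : R := (2 ^+ n * x * (2 ^+ n * (b * h)) + 2 ^+ n * (4 * M * (b * h) ^+ 2)).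
pose ga : R := 4 * M * (b * h) ^+ 2.
have ga0 : 0 <= ga by rewrite !mulr_ge0// sqr_ge0.
have bh0 : 0 <= b * h by rewrite mulr_ge0// ltW.
have al0 : 0 <= al by rewrite addr_ge0// !mulr_ge0// ltW.
have r0 : 0 <= (1 + x)^-1 by rewrite invr_ge0 addr_ge0// ltW.
have r1 : (1 + x)^-1 < 1 by rewrite invf_lt1 ?ltrDl// addr_gt0.
pose E1 (t : nat) : R := D * (b * h) * (D * (2^-1) ^+ t) + ga.
pose E2 (t : nat) : R := al * (D * (2^-1) ^+ t) + ga * ((1 + x)^-1) ^+ t.
have E10 t : 0 <= E1 t by rewrite addr_ge0// !mulr_ge0// exprn_ge0.
have E20 t : 0 <= E2 t by rewrite addr_ge0// !mulr_ge0// exprn_ge0.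
have half l := sum_half_ndist_le R d l.
have S1 l : \sum_(j < d) E1 (ndist l j) <= (CU - c1) * h.
  rewrite (sum_affine d (D * (b * h)) D ga (fun j => 2^-1 ^+ ndist l j)).
  apply: le_trans (_ : D * (b * h) * (D * 4) + ga * d%:R <= _).
    rewrite lerD2r; apply: ler_wpM2l; first exact: mulr_ge0.
    exact: ler_wpM2l.
  have -> : (CU - c1) * h = D * (b * h) * (D * 4) + 4 * M * b ^+ 2 * h * (2 * n.+1%:R).
    by rewrite /CU; ring.
  rewrite lerD2l (_ : ga * d%:R = 4 * M * b ^+ 2 * h * (h * d%:R)); last first.
    by rewrite /ga; ring.
  by rewrite ler_wpM2l// !mulr_ge0 ?sqr_ge0// ltW.
have S2 l : \sum_(j < d) E2 (ndist l j) <= c1 * h / 4.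
  rewrite big_split /= -!mulr_sumr.
  have a1 : al * (D * \sum_(j < d) (2^-1 : R) ^+ ndist l j) <= c1 * h / 8.
    apply: le_trans (_ : al * (D * 4) <= _).
      by rewrite ler_wpM2l// ler_wpM2l.
    rewrite (_ : al * (D * 4) = 4 * (Q * h) * h); last by rewrite /al /Q /x /D; ring.
    rewrite (_ : c1 * h / 8 = 4 * (c1 / 32) * h); last by field.
    rewrite ler_wpM2r ?(ltW h0)// ler_wpM2l//.
    move: hQ; rewrite ltr_pdivlMr; last by rewrite mulr_gt0// ltr_wpDl.
    move=> hQ; rewrite ler_pdivlMr//; apply: le_trans (ltW hQ).
    rewrite -subr_ge0 (_ : h * (32 * (Q + 1)) - Q * h * 32 = 32 * h); last by ring.
    by rewrite mulr_ge0// ltW.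
  have a2 : ga * \sum_(j < d) (1 + x)^-1 ^+ ndist l j <= c1 * h / 8.
    apply: le_trans (_ : ga * (4 / x) <= _).
      rewrite ler_wpM2l//; apply: le_trans (sum_ndist_le d l r0 r1) _.
      rewrite (_ : 2 / (1 - (1 + x)^-1) = 2 * (1 + x) / x); last first.
        by field; rewrite !gt_eqF// ?addr_gt0// (_ : 1 + x - 1 = x)//; ring.
      by rewrite ler_wpM2r ?invr_ge0 ?(ltW x0)//; lra.
    rewrite (_ : ga * (4 / x) = (128 * M * b ^+ 2) / lam * (h / 8)); last first.
      by rewrite /ga /x; field; rewrite !gt_eqF.
    rewrite -[c1 * h / 8]mulrA; apply: ler_wpM2r; first by rewrite divr_ge0// ltW.
    by rewrite ler_pdivrMr// [leRHS]mulrC -ler_pdivrMr// /lam lerDl.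
  by rewrite (_ : c1 * h / 4 = c1 * h / 8 + c1 * h / 8) ?lerD//; field.
pose ww (i : 'I_(3 * d)) := wgt x (i %/ d) (i %% d).
have wb i : L^-1 <= ww i <= L.
  apply: wgt_bounds; first exact: ltW.
  rewrite /x -mulrA ler_wpM2l ?(ltW lam0)//; apply: le_trans hd.
  by rewrite ler_wpM2l ?(ltW h0)// ler_nat ltnW// ltn_pmod.
have w0 i : 0 < ww i.
  by have /andP[wi _] := wb i; apply: lt_le_trans wi; rewrite invr_gt0.
have wr i j : 0 <= ww i / ww j <= L ^+ 2.
  rewrite divr_ge0 ?(ltW (w0 _))//= expr2 ler_pM ?invr_ge0 ?(ltW (w0 _))//.
    by case/andP: (wb i).
  have /andP[wj _] := wb j.
  by rewrite -[leRHS]invrK lef_pV2 ?posrE ?invr_gt0.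
have Lup i j : normc (Lm i j) <=
    if (i %/ d == j %/ d)%N then E1 (ndist (i %% d) (j %% d)) else 0.
  by have := normc_lim_entry_le n (i %/ d) (i %% d) (j %/ d) (j %% d) N0 bk; rewrite bE.
have Llow i j : normc ((ww i / ww j)%:C%C * Lm i j - (g i j)%:C%C) <=
    if (i %/ d == j %/ d)%N then E2 (ndist (i %% d) (j %% d)) else 0.
  by have := conj_entry_le n (i %/ d) (i %% d) (j %/ d) (j %% d) N0 bk xle; rewrite bE.
have sumC (E : nat -> R) (S : R) (j : 'I_(3 * d)) : (forall t, 0 <= E t) ->
    (forall l, \sum_(i < d) E (ndist l i) <= S) ->
    \sum_(i < 3 * d) (if (i %/ d == j %/ d)%N then E (ndist (i %% d) (j %% d)) else 0)
    <= S.
  move=> e0 eS; apply: le_trans (row_sum_le j e0 eS); apply: ler_sum => i _.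
  by rewrite eq_sym ndistC.
have sumc (c : R) : \sum_(i < 3 * d) c = (3 * d)%:R * c.
  by rewrite sumr_const card_ord mulr_natl.
have gP (a : 'I_(3 * d) -> R) :
    c1 * h * (\sum_i a i ^+ 2) <= \sum_i \sum_j a i * a j * g i j.
  pose a' t := if insub t is Some j then a j else 0.
  have a'E i : a' (val i) = a i by rewrite /a' valK.
  have := @gram_block_form R n N (c1 * h) a' (fun a => stab N a N0).
  rewrite -/d (eq_bigr (fun i => a i ^+ 2)); last by move=> i _; rewrite a'E.
  move/le_trans; apply; rewrite le_eqVlt; apply/orP; left; apply/eqP.
  by apply: eq_bigr => i _; apply: eq_bigr => j _; rewrite !a'E.
have ch2 : c1 * h - c1 * h / 2 = c1 * h / 2 by field.
(* Both bounds are proportional to [h], which cancels: the condition number is bounded independently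
   of the mesh. *)
rewrite (_ : CU / (c1 / 2 / L ^+ 2) =
    CU * h / ((c1 * h - c1 * h / 2) / L ^+ 2)); last first.
  by rewrite ch2; field; rewrite !gt_eqF.
apply: Cond_le => [||v|v].
- exact: mulr_gt0.
- apply: divr_gt0 => //; rewrite ch2; exact: divr_gt0.
- apply: (schur_upper (e := fun i j => (if (i %/ d == j %/ d)%N
    then E1 (ndist (i %% d) (j %% d)) else 0) + eps)).
  + exact: mulr_gt0.
  + move=> i j; rewrite -[X in normc X](subrK (Lm i j)) addrC.
    by apply: le_trans (ler_normcD _ _) _; apply: lerD; [exact: Lup|exact: (hA (i, j))].
  + move=> i; rewrite big_split /= sumc.
    apply: le_trans (lerD (row_sum_le i E10 S1) epsle) _.
    by rewrite -mulrDl subrK.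
  + move=> j; rewrite big_split /= sumc.
    apply: le_trans (lerD (sumC _ _ j E10 S1) epsle) _.
    by rewrite -mulrDl subrK.
(* The remainder takes a quarter and the distance to the limit an eighth of [c1 h], which leaves at
   least half of the coercivity of the Gram matrix. *)
have sumE (s : R) : s <= c1 * h / 4 -> s + (3 * d)%:R * (L ^+ 2 * eps) <= c1 * h / 2.
  by move=> s1; rewrite epsL; move: (c1 * h) ch0 s1 => u u0 s1; lra.
apply: (weighted_lower (g := g) (w := ww) (e := fun i j => (if (i %/ d == j %/ d)%N
    then E2 (ndist (i %% d) (j %% d)) else 0) + L ^+ 2 * eps)) => //.
- by rewrite ltr_pdivrMr// ltr_pMr// ltr1n.
- by move=> i; case/andP: (wb i).
- by move=> i; case/andP: (wb i).
- move=> i j; apply: le_trans (normc_mulB_le _ _ (Lm i j) _) _.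
  apply: lerD; first exact: Llow.
  rewrite normc_real ger0_norm; last by case/andP: (wr i j).
  by apply: ler_pM; [case/andP: (wr i j)|exact: normc_ge0|case/andP: (wr i j)|
    exact: (hA (i, j))].
- by move=> i; rewrite big_split /= sumc; apply/sumE/row_sum_le.
- by move=> j; rewrite big_split /= sumc; apply/sumE/sumC.
Qed.
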